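(* Let $M$ be a Sinnott module over $\Lambda=\mathbb{Z}_\ell[[\Gamma]]$. Then the numbers $$r_n=\frac{\mathrm{rank}_{\mathbb{Z}_\ell}\varepsilon_nM}{f_n(\ell,p)},\qquad \rho_n=\frac{\mathrm{rank}_\ell\,\varepsilon_nM}{f_n(\ell,p)}\qquad\text{and (if } M \text{ is torsion)}\qquad t_n=\frac{v_\ell(|\varepsilon_nM|)}{f_n(\ell,p)}$$ are all in $\mathbb{N}$. Put $M(n):=\bigoplus_{m=0}^n\varepsilon_mM$. In the formulas below, the terms $r_m$ with $m>n$ are omitted. If $p\neq2$, then for every $n\geqslant0$, $$\mathrm{rank}_{\mathbb{Z}_\ell}M(n)=\sum_{m=0}^nf_m(\ell,p)r_m=r_0+f_1(\ell,p)\left(\sum_{m=1}^{a(\ell,p)}r_m+\sum_{m=a(\ell,p)+1}^np^{m-a(\ell,p)}r_m\right).$$ If $p=2$ and $\ell\equiv1\pmod 4$, then for every $n\geqslant0$, $$\mathrm{rank}_{\mathbb{Z}_\ell}M(n)=\sum_{m=0}^nf_m(\ell,2)r_m=\sum_{m=0}^{a(\ell,2)}r_m+\sum_{m=a(\ell,2)+1}^n2^{m-a(\ell,2)}r_m.$$ If $p=2$ and $\ell\equiv3\pmod4$, then for every $n\geqslant0$, $$\mathrm{rank}_{\mathbb{Z}_\ell}M(n)=\sum_{m=0}^nf_m(\ell,2)r_m=r_0+r_1+2\left(\sum_{m=2}^{a(\ell,2)}r_m+\sum_{m=a(\ell,2)+1}^n2^{m-a(\ell,2)}r_m\right).$$ The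 same formulas hold for $\mathrm{rank}_\ell M(n)$, replacing all $r_m$ with $\rho_m$, and, if $M$ is torsion, for $v_\ell(|M(n)|)$, replacing all $r_m$ with $t_m$.
   Context: Let $\ell\neq p$ be primes and $\Gamma=\varprojlim_{n\in\mathbb{N}}\Gamma_n$ with $\Gamma_n$ finite abelian $p$-groups and surjective transition maps; $G_n=\mathrm{Ker}(\Gamma\to\Gamma_n)$; $\Lambda=\mathbb{Z}_\ell[[\Gamma]]=\varprojlim\mathbb{Z}_\ell[\Gamma_n]$. Fix $\overline{\mathbb{Q}}\hookrightarrow\overline{\mathbb{Q}}_\ell$. $\Gamma^\vee$ is the group of continuous characters of $\Gamma$ with values in roots of unity (in $\overline{\mathbb{Q}}_\ell$), with the action of $G_{\mathbb{Q}_\ell}=\mathrm{Gal}(\overline{\mathbb{Q}}_\ell/\mathbb{Q}_\ell)$ given by $(\sigma\cdot\omega)(\gamma)=\sigma(\omega(\gamma))$; $\mathscr{R}$ is the set of orbits $[\omega]$. For each $[\omega]$, $e_{[\omega]}\in\Lambda$ is the idempotent whose image in $\mathbb{Z}_\ell[\Gamma_n]$ is $\sum_{\chi\in[\omega]}\frac1{|\Gamma_n|}\sum_{\gamma\in\Gamma_n}\chi(\gamma^{-1})\gamma$ if $\omega$ factors through $\Gamma_n$, and $0$ otherwise. $\Lambda_{[\omega]}=e_{[\omega]}\Lambda\simeq\mathbb{Z}_\ell[\omega(\Gamma)]$, $\Lambda=\prod_{[\omega]}\Lambda_{[\omega]}$, and $M_{[\omega]}=e_{[\omega]}M$ for a $\Lambda$-module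 $M$. $I_n\subseteq\Lambda$ is the ideal generated by $\{\gamma-1:\gamma\in G_n\}$. $\mathscr{S}_n=\{[\omega]\in\mathscr{R}:\omega(\Gamma)=\boldsymbol{\mu}_{p^n}\}$ and $\varepsilon_n=\sum_{[\omega]\in\mathscr{S}_n}e_{[\omega]}\in\Lambda$ (a convergent sum). A $\Lambda$-module $M$ is a Sinnott module if every $M_{[\omega]}$ is a finitely generated $\Lambda_{[\omega]}$-module (locally finitely generated), the natural map $M\to\varprojlim M/I_nM$ is bijective ($I_\bullet$-complete), and for every $n$ the set $\{[\omega]\in\mathscr{S}_n:M_{[\omega]}\neq0\}$ is finite. It is torsion if every $M_{[\omega]}$ is a torsion $\Lambda_{[\omega]}$-module. For a finitely generated $\mathbb{Z}_\ell$-module $N$, $\mathrm{rank}_\ell N=\dim_{\mathbb{F}_\ell}N/\ell N$. $f_n(\ell,p)=[\mathbb{Q}_\ell(\boldsymbol{\mu}_{p^n}):\mathbb{Q}_\ell]$, the order of $\ell$ in $(\mathbb{Z}/p^n\mathbb{Z})^*$. $a(\ell,p)=v_p(\ell^{f_1(\ell,p)}-1)$ for $p\neq2$; $a(\ell,2)=v_2(\ell-1)$ if $\ell\equiv1\pmod4$; $a(\ell,2)=v_2(\ell^2-1)$ if $\ell\equiv3\pmod4$.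
   Formalization: I_n is taken to be the closed ideal generated by the γ−1 with γ∈G_n (the kernel of Λ→Z_ℓ[Γ_n]); this agrees with the plain ideal if Γ is topologically finitely generated, and the statement with the plain ideal is false in general (e.g. Γ=∏F_p). *)

(* Defs.v *)
From HB Require Import structures.
From mathcomp Require Import all_boot all_order all_algebra all_fingroup.
From mathcomp Require Import all_solvable.
From mathcomp Require Import boolp classical_sets functions cardinality fsbigop.
From mathcomp Require Import finmap.

Set Implicit Arguments.
Unset Strict Implicit.
Unset Printing Implicit Defensive.

Import GRing.Theory Num.Theory.

Local Open Scope classical_set_scope.
Local Open Scope ring_scope.

Record ringlim (R : nat -> pzRingType)
    (phi : forall n, {rmorphism R n.+1 -> R n}) := RingLim {
  ringlim_val :> forall n, R n;
  ringlim_coh : forall n, phi n (ringlim_val n.+1) = ringlim_val n }.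

Lemma ringlim_eq (R : nat -> pzRingType)
    (phi : forall n, {rmorphism R n.+1 -> R n}) (x y : ringlim phi) :
  (forall n, x n = y n) -> x = y.
Proof.
case: x y => [x hx] [y hy] /= exy.
have xy : x = y by exact: functional_extensionality_dep.
by subst y; congr RingLim; exact: Prop_irrelevance.
Qed.

HB.instance Definition _ R phi := gen_eqMixin (@ringlim R phi).
HB.instance Definition _ R phi := gen_choiceMixin (@ringlim R phi).

Section RingLim.
Context (R : nat -> pzRingType) (phi : forall n, {rmorphism R n.+1 -> R n}).
Implicit Types x y z : ringlim phi.

Lemma ringlim_zero_coh n : phi n 0 = 0. Proof. exact: rmorph0. Qed.
Lemma ringlim_one_coh n : phi n 1 = 1. Proof. exact: rmorph1. Qed.
Lemma ringlim_opp_coh x n : phi n (- x n.+1) = - x n.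
Proof. by rewrite rmorphN ringlim_coh. Qed.
Lemma ringlim_add_coh x y n : phi n (x n.+1 + y n.+1) = x n + y n.
Proof. by rewrite rmorphD !ringlim_coh. Qed.
Lemma ringlim_mul_coh x y n : phi n (x n.+1 * y n.+1) = x n * y n.
Proof. by rewrite rmorphM !ringlim_coh. Qed.

Definition ringlim_zero : ringlim phi :=
  @RingLim R phi (fun n => 0) ringlim_zero_coh.
Definition ringlim_one : ringlim phi :=
  @RingLim R phi (fun n => 1) ringlim_one_coh.
Definition ringlim_opp x : ringlim phi :=
  @RingLim R phi (fun n => - x n) (ringlim_opp_coh x).
Definition ringlim_add x y : ringlim phi :=
  @RingLim R phi (fun n => x n + y n) (ringlim_add_coh x y).
Definition ringlim_mul x y : ringlim phi :=
  @RingLim R phi (fun n => x n * y n) (ringlim_mul_coh x y).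

Lemma ringlim_addA : associative ringlim_add.
Proof. by move=> x y z; apply: ringlim_eq => n /=; rewrite addrA. Qed.
Lemma ringlim_addC : commutative ringlim_add.
Proof. by move=> x y; apply: ringlim_eq => n /=; rewrite addrC. Qed.
Lemma ringlim_add0 : left_id ringlim_zero ringlim_add.
Proof. by move=> x; apply: ringlim_eq => n /=; rewrite add0r. Qed.
Lemma ringlim_addN : left_inverse ringlim_zero ringlim_opp ringlim_add.
Proof. by move=> x; apply: ringlim_eq => n /=; rewrite addNr. Qed.
Lemma ringlim_mulA : associative ringlim_mul.
Proof. by move=> x y z; apply: ringlim_eq => n /=; rewrite mulrA. Qed.
Lemma ringlim_mul1l : left_id ringlim_one ringlim_mul.
Proof. by move=> x; apply: ringlim_eq => n /=; rewrite mul1r. Qed.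
Lemma ringlim_mul1r : right_id ringlim_one ringlim_mul.
Proof. by move=> x; apply: ringlim_eq => n /=; rewrite mulr1. Qed.
Lemma ringlim_mulDl : left_distributive ringlim_mul ringlim_add.
Proof. by move=> x y z; apply: ringlim_eq => n /=; rewrite mulrDl. Qed.
Lemma ringlim_mulDr : right_distributive ringlim_mul ringlim_add.
Proof. by move=> x y z; apply: ringlim_eq => n /=; rewrite mulrDr. Qed.

HB.instance Definition _ := GRing.isZmodule.Build (ringlim phi)
  ringlim_addA ringlim_addC ringlim_add0 ringlim_addN.
HB.instance Definition _ := GRing.Zmodule_isPzRing.Build (ringlim phi)
  ringlim_mulA ringlim_mul1l ringlim_mul1r ringlim_mulDl ringlim_mulDr.

End RingLim.

Record grplim (G : nat -> finGroupType)
    (t : forall n, {morphism [set: G n.+1]%SET >-> G n}) := GrpLim {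
  grplim_val :> forall n, G n;
  grplim_coh : forall n, t n (grplim_val n.+1) = grplim_val n }.

Lemma grplim_eq (G : nat -> finGroupType)
    (t : forall n, {morphism [set: G n.+1]%SET >-> G n}) (x y : grplim t) :
  (forall n, x n = y n) -> x = y.
Proof.
case: x y => [x hx] [y hy] /= exy.
have xy : x = y by exact: functional_extensionality_dep.
by subst y; congr GrpLim; exact: Prop_irrelevance.
Qed.

HB.instance Definition _ G t := gen_eqMixin (@grplim G t).
HB.instance Definition _ G t := gen_choiceMixin (@grplim G t).

Section GrpLim.
Context (G : nat -> finGroupType) (t : forall n, {morphism [set: G n.+1]%SET >-> G n}).
Implicit Types x y z : grplim t.
Local Open Scope group_scope.

Lemma grplim_one_coh n : t n 1 = 1. Proof. exact: morph1. Qed.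
Lemma grplim_inv_coh x n : t n (x n.+1)^-1 = (x n)^-1.
Proof. by rewrite morphV ?inE // grplim_coh. Qed.
Lemma grplim_mul_coh x y n : t n (x n.+1 * y n.+1) = x n * y n.
Proof. by rewrite morphM ?inE // !grplim_coh. Qed.

Definition grplim_one : grplim t := @GrpLim G t (fun n => 1) grplim_one_coh.
Definition grplim_inv x : grplim t :=
  @GrpLim G t (fun n => (x n)^-1) (grplim_inv_coh x).
Definition grplim_mul x y : grplim t :=
  @GrpLim G t (fun n => x n * y n) (grplim_mul_coh x y).

Lemma grplim_mulA : associative grplim_mul.
Proof. by move=> x y z; apply: grplim_eq => n /=; rewrite mulgA. Qed.
Lemma grplim_mul1l : left_id grplim_one grplim_mul.
Proof. by move=> x; apply: grplim_eq => n /=; rewrite mul1g. Qed.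
Lemma grplim_mul1r : right_id grplim_one grplim_mul.
Proof. by move=> x; apply: grplim_eq => n /=; rewrite mulg1. Qed.
Lemma grplim_mulVl : left_inverse grplim_one grplim_inv grplim_mul.
Proof. by move=> x; apply: grplim_eq => n /=; rewrite mulVg. Qed.
Lemma grplim_mulVr : right_inverse grplim_one grplim_inv grplim_mul.
Proof. by move=> x; apply: grplim_eq => n /=; rewrite mulgV. Qed.

HB.instance Definition _ := isGroup.Build (grplim t)
  grplim_mulA grplim_mul1l grplim_mul1r grplim_mulVl grplim_mulVr.

End GrpLim.

Definition grpring (R : pzRingType) (G : finGroupType) := {ffun G -> R}.
HB.instance Definition _ R G := Equality.copy (grpring R G) {ffun G -> R}.
HB.instance Definition _ R G := Choice.copy (grpring R G) {ffun G -> R}.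
HB.instance Definition _ R G := GRing.Zmodule.copy (grpring R G) {ffun G -> R}.

Section GroupRing.
Context (R : pzRingType) (G : finGroupType).
Implicit Types u v w : grpring R G.

Definition grp_elt (a : R) (g : G) : grpring R G :=
  [ffun x => if x == g then a else 0].

Definition grpring_mul u v : grpring R G :=
  [ffun x => \sum_y u y * v (y^-1 * x)%g].

Lemma grpring_mulA : associative grpring_mul.
Proof.
move=> u v w; apply/ffunP => x; rewrite !ffunE.
under eq_bigr => y _ do rewrite ffunE mulr_sumr.
under [RHS]eq_bigr => z _ do rewrite ffunE mulr_suml.
rewrite [RHS]exchange_big; apply: eq_bigr => y _ /=.
rewrite [RHS](reindex_inj (mulgI y)); apply: eq_bigr => z _ /=.
by rewrite mulrA mulKg invMg !mulgA.
Qed.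

Lemma grpring_mul1l : left_id (grp_elt 1 1%g) grpring_mul.
Proof.
move=> u; apply/ffunP => x; rewrite ffunE (bigD1 1%g) //= ffunE eqxx mul1r.
rewrite invg1 mul1g big1 ?addr0 // => y /negPf y1.
by rewrite ffunE y1 mul0r.
Qed.

Lemma grpring_mul1r : right_id (grp_elt 1 1%g) grpring_mul.
Proof.
move=> u; apply/ffunP => x; rewrite ffunE (bigD1 x) //= ffunE mulVg eqxx mulr1.
rewrite big1 ?addr0 // => y y1; rewrite ffunE -eq_mulVg1.
by rewrite (negPf y1) mulr0.
Qed.

Lemma grpring_mulDl : left_distributive grpring_mul +%R.
Proof.
move=> u v w; apply/ffunP => x; rewrite !ffunE -big_split.
by apply: eq_bigr => y _; rewrite ffunE mulrDl.
Qed.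

Lemma grpring_mulDr : right_distributive grpring_mul +%R.
Proof.
move=> u v w; apply/ffunP => x; rewrite !ffunE -big_split.
by apply: eq_bigr => y _; rewrite ffunE mulrDr.
Qed.

HB.instance Definition _ := GRing.Zmodule_isPzRing.Build (grpring R G)
  grpring_mulA grpring_mul1l grpring_mul1r grpring_mulDl grpring_mulDr.

End GroupRing.

Section PushForward.
Context (R : pzRingType) (G H : finGroupType) (h : {morphism [set: G]%SET >-> H}).

Definition grpring_map (u : grpring R G) : grpring R H :=
  [ffun y => \sum_(x | h x == y) u x].

Lemma grpring_map_is_zmod_morphism : zmod_morphism grpring_map.
Proof.
move=> u v; apply/ffunP => y; rewrite !ffunE -sumrN -big_split.
by apply: eq_bigr => x _; rewrite !ffunE.
Qed.

Lemma grpring_map_is_monoid_morphism : monoid_morphism grpring_map.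
Proof.
split=> [|u v]; apply/ffunP => y; rewrite !ffunE.
  under eq_bigr => x _ do rewrite ffunE.
  rewrite -big_mkcondr /=; case: eqP => [->|/eqP y1].
    rewrite (big_pred1 1%g) // => x; apply/andP/eqP => [[_ /eqP] //|->].
    by rewrite morph1.
  rewrite big_pred0 // => x; apply/negP => /andP[/eqP hx /eqP x1].
  by rewrite -hx x1 morph1 eqxx in y1.
under eq_bigr => x _ do rewrite ffunE.
rewrite exchange_big /=.
rewrite (partition_big h predT) //=; apply: eq_bigr => z _.
rewrite ffunE mulr_suml; apply: eq_bigr => x /eqP hx.
rewrite ffunE mulr_sumr (reindex_inj (mulgI x)) /=.
apply: eq_big => [w|w _]; last by rewrite mulKg.
by rewrite morphM ?inE // hx -(inj_eq (mulgI z^-1)%g) mulKg.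
Qed.

HB.instance Definition _ := GRing.isZmodMorphism.Build _ _ grpring_map
  grpring_map_is_zmod_morphism.
HB.instance Definition _ := GRing.isMonoidMorphism.Build _ _ grpring_map
  grpring_map_is_monoid_morphism.

End PushForward.

Arguments grpring_map R {G H} h u.

(* For a prime l, l ^ k.+1 > 1, so that ['Z_(l ^ k.+1)] is indeed Z/l^(k+1). *)
Section PadicIntegers.
Context (l k : nat).

Definition Zl_red (x : 'Z_(l ^ k.+2)) : 'Z_(l ^ k.+1) := inZp x.

Lemma Zp_modulus_dvd : ((Zp_trunc (l ^ k.+1)).+2 %| (Zp_trunc (l ^ k.+2)).+2)%N.
Proof.
case: l => [|[|m]]; rewrite ?exp0n ?exp1n //.
have m_gt1 i : (1 < m.+2 ^ i.+1)%N by rewrite -(expn0 m.+2) ltn_exp2l.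
by rewrite (Zp_cast (m_gt1 k)) (Zp_cast (m_gt1 k.+1)) dvdn_exp2l.
Qed.

Lemma Zl_redD : {morph Zl_red : x y / x + y}.
Proof.
move=> x y; apply: val_inj; rewrite /= (modn_dvdm _ Zp_modulus_dvd).
by rewrite modnDm.
Qed.

Lemma Zl_red_is_zmod_morphism : zmod_morphism Zl_red.
Proof. by move=> x y; apply/eqP; rewrite eq_sym subr_eq -Zl_redD subrK. Qed.

Lemma Zl_red_is_monoid_morphism : monoid_morphism Zl_red.
Proof.
split=> [|x y]; apply: val_inj; rewrite /= ?(modn_dvdm _ Zp_modulus_dvd) //.
by rewrite modnMm.
Qed.

HB.instance Definition _ := GRing.isZmodMorphism.Build _ _ Zl_red
  Zl_red_is_zmod_morphism.
HB.instance Definition _ := GRing.isMonoidMorphism.Build _ _ Zl_red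
  Zl_red_is_monoid_morphism.

End PadicIntegers.

Definition Zl (l : nat) :=
  @ringlim (fun k => 'Z_(l ^ k.+1)) (fun k => @Zl_red l k).
HB.instance Definition _ l := GRing.PzRing.on (Zl l).

Section AlgebraicClosure.
Context (l : nat) (L : closedFieldType) (iota : {rmorphism Zl l -> L}).

Definition Ql : set L :=
  [set z | exists a b, iota b != 0 /\ z = iota a / iota b].

Definition algebraic_closure_of_Ql : Prop :=
  injective iota /\
  forall z : L, exists2 P : {poly L}, P != 0 & (forall i, Ql P`_i) /\ root P z.

Definition absolute_galois_group : set {rmorphism L -> L} :=
  [set s | bijective s /\ forall z, Ql z -> s z = z].

Definition mu (m : nat) : set L := [set z | z ^+ m = 1].

(* Q_l(mu_m): the intersection of the subfields containing Q_l and mu_m *)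
Definition cyclotomic_field (m : nat) : set L :=
  [set z | forall K : {pred L}, divring_closed K ->
    (forall x, Ql x -> x \in K) -> (forall x, mu m x -> x \in K) -> z \in K].

End AlgebraicClosure.

(* the largest element of P, and 0 if there is none *)
Definition max_nat (P : set nat) : nat :=
  xget 0%N [set k | P k /\ forall j, P j -> (j <= k)%N].

(* f_n(l,p) = [Q_l(mu_(p^n)) : Q_l], the dimension being computed as the
   largest size of a family that is linearly independent over Q_l *)
Definition cyclotomic_degree (l : nat) (L : closedFieldType)
    (iota : {rmorphism Zl l -> L}) (p n : nat) : nat :=
  max_nat [set k | exists x : 'I_k -> L,
    (forall i, cyclotomic_field iota (p ^ n) (x i)) /\
    forall c : 'I_k -> L, (forall i, Ql iota (c i)) ->
      \sum_i c i * x i = 0 -> forall i, c i = 0].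

(* a(l,p); f1 stands for f_1(l,p) *)
Definition a_const (l p f1 : nat) : nat :=
  (if p != 2 then logn p (l ^ f1 - 1)
   else if l %% 4 == 1 then logn 2 (l - 1) else logn 2 (l ^ 2 - 1))%N.

Section Modules.
Context (A : pzRingType).
Implicit Type M : lmodType A.

(* the left ideal generated by S; it will only be used for commutative A *)
Definition ideal_span (S : set A) : set A :=
  [set x | exists k (a s : 'I_k -> A),
    (forall i, S (s i)) /\ x = \sum_i a i * s i].

Definition ideal_smul (I : set A) M : set M :=
  [set x | exists k (a : 'I_k -> A) (m : 'I_k -> M),
    (forall i, I (a i)) /\ x = \sum_i a i *: m i].

(* the natural map from M to the inverse limit of the M/I_n M is injective,
   respectively surjective *)
Definition adically_complete (I : nat -> set A) M : Prop :=
  (forall x : M, (forall n, ideal_smul (I n) x) -> x = 0) /\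
  (forall u : nat -> M, (forall n, ideal_smul (I n) (u n.+1 - u n)) ->
     exists x, forall n, ideal_smul (I n) (x - u n)).

Definition component (e : A) M : set M := range (fun m : M => e *: m).

(* N is finitely generated over B, where B is closed under the ring operations
   of A (possibly with another unit) and N is a B-submodule of M *)
Definition finitely_generated (B : set A) M (N : set M) : Prop :=
  exists k (x : 'I_k -> M), (forall i, N (x i)) /\
    forall y, N y -> exists2 a : 'I_k -> A,
      forall i, B (a i) & y = \sum_i a i *: x i.

(* B is meant to be an integral domain *)
Definition torsion_over (B : set A) M (N : set M) : Prop :=
  forall x, N x -> exists2 a, B a & a != 0 /\ a *: x = 0.

End Modules.

Arguments component {A} e M.

Section IwasawaAlgebra.
Context (l : nat) (Gam : nat -> finGroupType)
  (tr : forall n, {morphism [set: Gam n.+1]%SET >-> Gam n}).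

Definition Iwasawa : Type :=
  @ringlim (fun n => grpring (Zl l) (Gam n))
           (fun n => grpring_map (Zl l) (tr n)).
HB.instance Definition _ := GRing.PzRing.on Iwasawa.

Lemma iwasawa_elt_coh (a : Zl l) (g : grplim tr) n :
  grpring_map (Zl l) (tr n) (grp_elt a (g n.+1)) = grp_elt a (g n).
Proof.
apply/ffunP => y; rewrite !ffunE big_mkcond (bigD1 (g n.+1)) //=.
rewrite ffunE eqxx grplim_coh eq_sym big1 ?addr0 // => x /negPf xg.
by rewrite ffunE xg if_same.
Qed.

Definition iwasawa_elt (a : Zl l) (g : grplim tr) : Iwasawa :=
  @RingLim (fun n => grpring (Zl l) (Gam n)) _
    (fun n => grp_elt a (g n)) (iwasawa_elt_coh a g).

Definition ker_proj (n : nat) : set (grplim tr) := [set g | g n = 1%g].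

(* closure for the inverse limit topology, where Z_l[Gam k] has the l-adic
   topology *)
Definition iwasawa_closure (S : set Iwasawa) : set Iwasawa :=
  [set x : Iwasawa | forall k j : nat, exists2 y : Iwasawa, S y &
    forall g : Gam k, (x k : grpring (Zl l) (Gam k)) g j =
                      (y k : grpring (Zl l) (Gam k)) g j].

(* The ideal is generated in the sense of topological rings, that is, it is
   closed: it is the kernel of the projection to Z_l[Gam n]. The closure is
   redundant if Gamma is topologically finitely generated, but not in
   general. *)
Definition I_ideal (n : nat) : set Iwasawa :=
  iwasawa_closure (ideal_span [set iwasawa_elt 1 g - 1 | g in ker_proj n]).

Context (L : closedFieldType) (iota : {rmorphism Zl l -> L}).

(* Roots of unity of p-power order form a discrete group for the l-adic
   topology, so that continuity means local constancy; a basis of the topology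
   of Gamma consists of the fibers of the projections to the Gam n. *)
Definition continuous_character (w : grplim tr -> L) : Prop :=
  [/\ forall g h : grplim tr, w (g * h)%g = w g * w h,
      forall g : grplim tr, exists2 m, (0 < m)%N & mu m (w g) &
      forall g : grplim tr, exists n, forall h : grplim tr, h n = g n -> w h = w g].

Definition galois_orbit (w : grplim tr -> L) : set (grplim tr -> L) :=
  [set s \o w | s in absolute_galois_group iota].

Definition galois_orbits : set (set (grplim tr -> L)) :=
  [set galois_orbit w | w in continuous_character].

Definition factors_through (n : nat) (w : grplim tr -> L) : Prop :=
  exists psi : Gam n -> L, forall g, w g = psi (g n).

(* e_O; each x : Gam n is the image g n of some g in Gamma, and the coefficient
   of e_O at x, which belongs to L, is the image by iota of an element of Z_l *)
Definition orbit_idempotent (O : set (grplim tr -> L)) : Iwasawa :=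
  xget 0 [set e : Iwasawa | forall n,
    ((forall w, O w -> factors_through n w) ->
       forall g : grplim tr, iota (e n (g n)) =
         \sum_(w \in O) (#|Gam n|%:R)^-1 * w (g^-1)%g) /\
    (~ (forall w, O w -> factors_through n w) -> e n = 0)].

Definition orbits_of_level (p n : nat) : set (set (grplim tr -> L)) :=
  [set galois_orbit w | w in
     [set w | continuous_character w /\ range w = mu (p ^ n)]].

(* the sum converges in the inverse limit topology: in Z_l[Gam k] it has only
   finitely many nonzero terms *)
Definition epsilon (p n : nat) : Iwasawa :=
  xget 0 [set E : Iwasawa | forall k,
    E k = \sum_(O \in orbits_of_level p n) (orbit_idempotent O : Iwasawa) k].

End IwasawaAlgebra.

Arguments I_ideal l {Gam} tr n.

Section SinnottModules.
Context (l : nat) (Gam : nat -> finGroupType)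
  (tr : forall n, {morphism [set: Gam n.+1]%SET >-> Gam n}).
Context (L : closedFieldType) (iota : {rmorphism Zl l -> L}).
Implicit Type M : lmodType (Iwasawa l tr).

Local Notation e O := (orbit_idempotent iota O).
Local Notation Lambda_ O := (component (e O) (Iwasawa l tr)^o).

Record sinnott_module (p : nat) M : Prop := SinnottModule {
  sinnott_locally_fg : forall O, galois_orbits iota O ->
    finitely_generated (Lambda_ O) (component (e O) M);
  sinnott_complete : adically_complete (I_ideal l tr) M;
  sinnott_finite : forall n, finite_set
    [set O | orbits_of_level iota p n O /\ component (e O) M <> [set 0]] }.

Definition torsion_module M : Prop :=
  forall O, galois_orbits iota O -> torsion_over (Lambda_ O) (component (e O) M).

Definition Zl_scalars : set (Iwasawa l tr) :=
  range (fun a => iwasawa_elt a (1%g : grplim tr)).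

Definition Zl_rank M (N : set M) : nat :=
  max_nat [set k | exists x : 'I_k -> M, (forall i, N (x i)) /\
    forall c : 'I_k -> Zl l,
      \sum_i iwasawa_elt (c i) (1%g : grplim tr) *: x i = 0 ->
      forall i, c i = 0].

(* the dimension of N / l N over F_l, as the largest number of elements of N
   whose images in N / l N are linearly independent *)
Definition rank_mod_l M (N : set M) : nat :=
  max_nat [set k | exists x : 'I_k -> M, (forall i, N (x i)) /\
    forall c : 'I_k -> 'F_l,
      [set y *+ l | y in N] (\sum_i x i *+ (c i : nat)) ->
      forall i, c i = 0].

Definition card_valuation (T : choiceType) (N : set T) : nat :=
  logn l #|` fset_set N|.

Definition direct_sum M (N : nat -> set M) (n : nat) :
    set {ffun 'I_n.+1 -> M} :=
  [set x : {ffun 'I_n.+1 -> M} | forall m : 'I_n.+1, N m (x m)].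

End SinnottModules.

Arguments Zl_scalars l {Gam} tr.
Arguments direct_sum {l Gam tr M} N n.

Definition omit_above (n : nat) (r : nat -> rat) (m : nat) : rat :=
  if (m <= n)%N then r m else 0.

Definition layer_formulas (l p a : nat) (f : nat -> nat) (r : nat -> rat)
    (n : nat) (X : rat) : Prop :=
  let r' := omit_above n r in
  [/\ X = \sum_(0 <= m < n.+1) (f m)%:R * r m,
      p <> 2%N ->
        X = r' 0%N + (f 1%N)%:R * (\sum_(1 <= m < a.+1) r' m
              + \sum_(a.+1 <= m < n.+1) (p ^ (m - a))%N%:R * r' m),
      p = 2%N -> (l = 1 %[mod 4])%N ->
        X = \sum_(0 <= m < a.+1) r' m
              + \sum_(a.+1 <= m < n.+1) (2 ^ (m - a))%N%:R * r' m &
      p = 2%N -> (l = 3 %[mod 4])%N ->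
        X = r' 0%N + r' 1%N + 2 * (\sum_(2 <= m < a.+1) r' m
              + \sum_(a.+1 <= m < n.+1) (2 ^ (m - a))%N%:R * r' m)].

(* Main.v *)
Require Import Defs.
From HB Require Import structures.
From mathcomp Require Import all_boot all_order all_algebra all_fingroup.
From mathcomp Require Import all_solvable.
From mathcomp Require Import boolp classical_sets functions cardinality fsbigop.
From mathcomp Require Import finmap zify.

(** Each of the three invariants (rank over Z_l, rank modulo l, and length in the
    torsion case) of a finitely generated Z_l-module N is log_l |N / K N|, where K N
    is a submodule that depends functorially on N: the multiples of l up to torsion,
    the multiples of l, and 0 (Zl_rank_of_quot_card, l_rank_of_quot_card,
    quot_card_torsion). In particular the three invariants are additive on direct
    sums. The proof then rests on two facts.

    First, the order d of l modulo p ^ n divides the invariants of epsilon_n M.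
    Completeness shows that epsilon_n M is a finite direct sum of components
    M_w = e_w M, for characters w with image mu_(p^n) (epsilon_decomposition). Let
    n > 0 and let gamma be such that w gamma is a primitive root of unity. Then
    gamma acts on M_w with order p ^ n and is annihilated by the cyclotomic
    polynomial, so that 1 + u + ... + u ^ (p - 1) = 0 on M_w, where
    u = gamma ^ (p ^ (n - 1)). Hence u fixes no nonzero element x of the finite group
    Q = M_w / K M_w, since u x = x implies p x = 0, and p is invertible in Z_l. All
    the nonzero orbits of gamma in Q have p ^ n elements, and |Q|, a power of l, is
    congruent to 1 modulo p ^ n: its exponent is a multiple of d (quot_card_free).
    This counting replaces the structure of M_w as a module over the discrete
    valuation ring Z_l[mu_(p^n)].

    Second, the degree of Q_l(mu_(p^n)) over Q_l is d. It is the rank of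
    O = Z_l[mu_(p^n)] over Z_l, which is a multiple of d by the same counting,
    applied to the multiplication by a primitive root of unity on O / l O. On the
    other hand, raising to the power l ^ d is the identity on O / l O, because it
    fixes the roots of unity and is additive modulo l. So x ^ (l ^ (d k)) converges
    in O, to a root of X ^ (l ^ d) - X congruent to x modulo l. Therefore O / l O has
    at most l ^ d elements (cyclotomic_integers_rank).

    The identities between the e_w all come from evaluating characters
    (mul_idempotentE, char_eval_idempotent), and the explicit formulas from the fact
    that the order of l modulo p ^ m is multiplied by p when m increases, as soon as
    m is at least a(l,p) (order_mod_tower). *)

Set Implicit Arguments.
Unset Strict Implicit.
Unset Printing Implicit Defensive.

Import GRing.Theory Num.Theory.

Local Open Scope classical_set_scope.
Local Open Scope ring_scope.

(** * Arithmetic of the l-adic integers *)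

Lemma Zl_mulrC l : commutative (@GRing.mul (Zl l)).
Proof. by move=> a b; apply: ringlim_eq => k /=; rewrite mulrC. Qed.

HB.instance Definition _ l :=
  GRing.PzRing_hasCommutativeMul.Build (Zl l) (@Zl_mulrC l).

Section PadicArithmetic.
Variable l : nat.
Hypothesis l_prime : prime l.
Implicit Types a b c r u : Zl l.

Lemma Zl_modulus k : ((Zp_trunc (l ^ k.+1)).+2 = l ^ k.+1)%N.
Proof. by rewrite Zp_cast // -(expn0 l) ltn_exp2l // prime_gt1. Qed.

Lemma Zl_inZp n k : (inZp n : 'Z_(l ^ k.+1)) = (n %% l ^ k.+1)%N :> nat.
Proof. by congr modn; rewrite Zl_modulus. Qed.

Lemma Zl_natE n k : (n%:R : Zl l) k = n%:R.
Proof. by elim: n => // n IHn; rewrite -natr1 -[RHS]natr1 -IHn. Qed.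

Lemma Zl_natE_val n k : ((n%:R : Zl l) k : nat) = (n %% l ^ k.+1)%N.
Proof. by rewrite Zl_natE val_Zp_nat ?Zl_modulus // -(expn0 l) ltn_exp2l // prime_gt1. Qed.

Lemma Zl_val_coh c k : (c k.+1 %% l ^ k.+1)%N = c k :> nat.
Proof.
have -> : (c k : nat) = (c k.+1 %% (Zp_trunc (l ^ k.+1)).+2)%N.
  by rewrite -[in LHS](ringlim_coh c k).
by congr modn; rewrite Zl_modulus.
Qed.

Lemma Zl_val_lt c k : (c k < l ^ k.+1)%N.
Proof. by apply: leq_trans (ltn_ord _) _; rewrite Zl_modulus. Qed.

Lemma Zl_val_lt0 c : (c 0%N < l)%N.
Proof. exact: Zl_val_lt. Qed.

Lemma Zl_mul_val a b k : ((a * b)%R k : nat) = (a k * b k %% l ^ k.+1)%N.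
Proof. by congr modn; rewrite Zl_modulus. Qed.

Lemma Zl_one_neq0 : (1 : Zl l) <> 0.
Proof. by move=> /(congr1 (fun c : Zl l => c 0%N)) /eqP; rewrite oner_eq0. Qed.

Lemma Zl_mull_inj c : l%:R * c = 0 -> c = 0.
Proof.
move=> lc0; apply: ringlim_eq => k; apply: val_inj => /=.
have /(congr1 (fun x : Zl l => x k.+1 : nat)) := lc0.
rewrite Zl_mul_val Zl_natE_val /= modnMml => /eqP.
rewrite -/(dvdn _ _) [X in (X %| _)%N]expnS dvdn_pmul2l ?prime_gt0 // => dv.
by rewrite -Zl_val_coh; apply/eqP.
Qed.

Lemma Zl_mullX_inj n c : l%:R ^+ n * c = 0 -> c = 0.
Proof.
by elim: n => [|n IHn]; rewrite ?mul1r // exprS -mulrA => /Zl_mull_inj/IHn.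
Qed.

Lemma Zl_div_l c : c 0%N = 0 -> exists r, c = l%:R * r.
Proof.
move=> c0.
have dv k : (l %| c k)%N.
  elim: k => [|k IHk]; first by rewrite c0 dvdn0.
  rewrite (divn_eq (c k.+1) (l ^ k.+1)) dvdn_add //; last by rewrite Zl_val_coh.
  by rewrite dvdn_mull // expnS dvdn_mulr.
pose s k : 'Z_(l ^ k.+1) := inZp (c k.+1 %/ l).
have coh k : Zl_red (s k.+1) = s k.
  apply: val_inj; rewrite /Zl_red /s [LHS]Zl_inZp [RHS]Zl_inZp.
  rewrite [X in (X %% _)%N]Zl_inZp.
  rewrite modn_dvdm ?dvdn_exp2l //; apply/eqP.
  rewrite -(eqn_pmul2r (prime_gt0 l_prime)) !muln_modl -!expnSr !divnK //.
  by rewrite Zl_val_coh modn_small // Zl_val_lt.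
exists (RingLim coh); apply: ringlim_eq => k; apply: val_inj.
rewrite [RHS]Zl_mul_val Zl_natE_val [X in (_ * X)%N]Zl_inZp modnMml modnMmr.
by rewrite mulnC divnK // Zl_val_coh.
Qed.

Lemma Zl_div_lX n c : (forall k, (k < n)%N -> c k = 0) ->
  exists r, c = l%:R ^+ n * r.
Proof.
elim: n c => [|n IHn] c c0; first by exists c; rewrite mul1r.
have [r cr] := Zl_div_l (c0 0%N isT).
have [s rs] : exists s, r = l%:R ^+ n * s.
  apply: IHn => k kn; apply: val_inj.
  have := c0 k.+1 kn; rewrite cr => /(congr1 val) /=.
  have := Zl_mul_val l%:R r k.+1 => /= -> /eqP.
  rewrite Zl_natE_val modnMml -/(dvdn _ _).
  rewrite [X in (X %| _)%N]expnS dvdn_pmul2l ?prime_gt0 // => dv.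
  by rewrite -Zl_val_coh; apply/eqP.
by exists s; rewrite cr rs exprS mulrA.
Qed.

(** Z_l is local: none of the c k is divisible by l if c 0 is not, so that they are
    all invertible, and their inverses are compatible. *)
Lemma Zl_unit c : c 0%N != 0 -> exists u, u * c = 1.
Proof.
move=> c0.
have cl k : ~~ (l %| c k)%N.
  elim: k => [|k IHk].
    apply: contra c0 => /eqP dv; apply/eqP/val_inj.
    by rewrite -[LHS](modn_small (Zl_val_lt0 c)).
  apply: contra IHk => dv; rewrite -Zl_val_coh.
  by rewrite /dvdn modn_dvdm ?expnS ?dvdn_mulr.
have cu k : c k \is a GRing.unit.
  rewrite -[c k]natr_Zp unitZpE ?Zl_modulus; last first.
    by rewrite -(expn0 l) ltn_exp2l // prime_gt1.
  rewrite coprimeXl // prime_coprime //.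
pose s k : 'Z_(l ^ k.+1) := (c k)^-1.
have coh k : Zl_red (s k.+1) = s k.
  rewrite /s rmorphV; last exact: cu.
  by rewrite -[in RHS](ringlim_coh c k).
exists (RingLim coh); apply: ringlim_eq => k; exact: mulVr (cu k).
Qed.

(** Here n is the first level at which some element of the family is not zero, so
    that l ^ n is the largest power of l that divides all of them. *)
Lemma Zl_factor_family (B : Type) (a : B -> Zl l) : (exists i, a i <> 0) ->
  exists n (a' : B -> Zl l) j,
    a' j 0%N != 0 /\ forall i, a i = l%:R ^+ n * a' i.
Proof.
move=> [i0 ai0].
pose P k := `[< exists i, a i k != 0 >].
have [k ck] : exists k, P k.
  apply: contrapT => /forallNP h; apply: ai0; apply: ringlim_eq => k.
  by apply/eqP/negPn/negP => aik; apply: (h k); apply/asboolP; exists i0.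
have [n /asboolP[j ajn] n_min] := ex_minnP (ex_intro (fun k => P k) k ck).
have /choice[a' aE] i : exists u, a i = l%:R ^+ n * u.
  apply: Zl_div_lX => m; apply: contraTeq => aim; rewrite -leqNgt.
  by apply: n_min; apply/asboolP; exists i.
exists n, a', j; split=> //; apply: contra_neq ajn => u0.
have [r ur] := Zl_div_l u0; apply: val_inj.
rewrite aE ur mulrA -exprSr -natrX [LHS]Zl_mul_val Zl_natE_val modnn mul0n.
by rewrite mod0n.
Qed.

Lemma Zl_factor c : c <> 0 -> exists n u, u 0%N != 0 /\ c = l%:R ^+ n * u.
Proof.
move=> c0; have [|n [a [j [aj cE]]]] := @Zl_factor_family unit (fun=> c).
  by exists tt.
by exists n, (a j).
Qed.

Lemma Zl_integral a b : a * b = 0 -> a = 0 \/ b = 0.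
Proof.
move=> ab0; have [->|/eqP a0] := eqVneq a 0; [by left|right].
have [n [u [u0 au]]] := Zl_factor a0; have [v vu] := Zl_unit u0.
have : v * (l%:R ^+ n * u * b) = l%:R ^+ n * b.
  by rewrite -mulrA mulrCA [v * _]mulrA vu mul1r.
by rewrite -au ab0 mulr0 => /esym/Zl_mullX_inj.
Qed.

Lemma Zl_unit_coprime n : coprime l n -> exists u, u * n%:R = 1.
Proof.
move=> ln; apply: Zl_unit; apply/eqP => /(congr1 val) /=.
rewrite -[nat_of_ord _]/((n%:R : Zl l) 0%N : nat) Zl_natE_val => /eqP.
rewrite expn1 -/(dvdn _ _) => dv.
by move: ln; rewrite prime_coprime // dv.
Qed.

Lemma Zl_residue c : exists (a : 'F_l) r, c = (a : nat)%:R + l%:R * r.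
Proof.
exists (inZp (c 0%N)).
have [|r cr] := @Zl_div_l (c - (c 0%N : nat)%:R).
  rewrite -[LHS]/(c 0%N - ((c 0%N : nat)%:R : Zl l) 0%N).
  by rewrite Zl_natE natr_Zp subrr.
by exists r; rewrite -cr /= Fp_cast // modn_small ?Zl_val_lt0 // subrKC.
Qed.

(** Completeness of Z_l: the partial sums converge at each finite level, because
    the terms of index m and more vanish modulo l ^ m. *)
Lemma Zl_series (b : nat -> Zl l) : exists c, forall m, exists r,
  c = \sum_(k < m) l%:R ^+ k * b k + l%:R ^+ m * r.
Proof.
pose S m := \sum_(k < m) l%:R ^+ k * b k.
have lX0 m (x : Zl l) k : (k < m)%N -> ((l%:R ^+ m * x : Zl l) k = 0).
  move=> km; apply: val_inj; rewrite -natrX [LHS]Zl_mul_val Zl_natE_val modnMml.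
  by apply/eqP; rewrite -/(dvdn _ _) dvdn_mulr // dvdn_exp2l.
have SS m k d : (k < m)%N -> S (m + d)%N k = S m k.
  move=> km; elim: d => [|d IHd]; first by rewrite addn0.
  have -> : S (m + d.+1)%N = S (m + d)%N + l%:R ^+ (m + d) * b (m + d)%N.
    by rewrite addnS /S big_ord_recr.
  rewrite -[LHS]/(S _ k + (l%:R ^+ (m + d) * b (m + d)%N : Zl l) k).
  by rewrite IHd lX0 ?addr0 // (leq_trans km) ?leq_addr.
have coh k : Zl_red (S k.+2 k.+1) = S k.+1 k.
  rewrite -(SS k.+1 k 1%N) // addn1.
  exact: (ringlim_coh (S k.+2) k).
exists (RingLim coh) => m.
have [|r dr] := @Zl_div_lX m (RingLim coh - S m); last by exists r; rewrite -dr subrKC.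
move=> k km; rewrite -[LHS]/(S k.+1 k - S m k).
by rewrite -(subnKC km) SS // subrr.
Qed.

End PadicArithmetic.

(** * Linear algebra over Z_l *)

Lemma max_nat_eq (P : set nat) k :
  P k -> (forall j, P j -> (j <= k)%N) -> max_nat P = k.
Proof.
move=> Pk k_max; rewrite /max_nat; apply: xget_unique => // j [Pj j_max].
by apply/eqP; rewrite eqn_leq k_max ?j_max.
Qed.

(** The proof is by elimination: multiplying by the pivot A p 0 instead of dividing
    by it clears the first column without leaving the domain. *)
Lemma linear_dependence (R : comPzRingType) :
  (1 : R) <> 0 -> (forall a b : R, a * b = 0 -> a = 0 \/ b = 0) ->
  forall s k (A : 'I_k -> 'I_s -> R), (s < k)%N ->
  exists c : 'I_k -> R, (exists j, c j <> 0) /\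
    forall i, \sum_j c j * A j i = 0.
Proof.
move=> one_neq0 integral; elim=> [|s IHs] [//|k] A sk.
  by exists (fun=> 1); split=> [|[]//]; exists ord0.
have [[p Ap]|/forallNP A0] := pselect (exists p, A p ord0 <> 0); last first.
  have [c [c0 cA]] := IHs k.+1 (fun j i => A j (lift ord0 i)) (ltnW sk).
  exists c; split=> // i; have [i' ->|->] := unliftP ord0 i; first exact: cA.
  by rewrite big1 // => j _; rewrite (contrapT (A0 j)) mulr0.
pose A' j i := A p ord0 * A (lift p j) (lift ord0 i)
               - A (lift p j) ord0 * A p (lift ord0 i).
have [c [[j0 cj0] cA]] := IHs k A' sk.
pose d := - \sum_j c j * A (lift p j) ord0.
exists (fun j => if unlift p j is Some j' then c j' * A p ord0 else d).
split; first by exists (lift p j0); rewrite liftK => /integral[].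
move=> i; rewrite (bigD1_ord p) //= unlift_none.
under eq_bigr do rewrite liftK.
have [i' ->|->] := unliftP ord0 i; last first.
  rewrite /d mulNr mulr_suml -sumrN -big_split big1 // => j _ /=.
  by rewrite mulrAC addNr.
rewrite -[RHS](cA i') /d mulNr mulr_suml -sumrN -big_split.
apply: eq_bigr => j _ /=; rewrite /A' mulrBr !mulrA addrC.
by congr (_ - _); rewrite mulrAC.
Qed.

Section ZlModules.
Variable l : nat.
Hypothesis l_prime : prime l.
Implicit Types V : lmodType (Zl l).

Definition subgroup (V : zmodType) (K : set V) :=
  K 0 /\ forall x y, K x -> K y -> K (x - y).

Definition submodule V (N : set V) :=
  subgroup N /\ forall (c : Zl l) x, N x -> N (c *: x).

Definition zspan V (B : finType) (g : B -> V) : set V :=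
  [set x | exists c : B -> Zl l, x = \sum_b c b *: g b].

Definition fin_gen V (N : set V) := exists (B : finType) (g : B -> V), N = zspan g.

(** The quotient N / K is finite with q elements: f is a system of
    representatives. *)
Definition quot_card (V : zmodType) (N K : set V) (q : nat) :=
  exists f : 'I_q -> V,
    [/\ forall x, N (f x), forall x y, K (f x - f y) -> x = y &
        forall v, N v -> exists x, K (v - f x)].

Lemma quot_card_intro (V : zmodType) (N K : set V) (X : finType) (f : X -> V) :
    (forall x, N (f x)) -> (forall x y, K (f x - f y) -> x = y) ->
    (forall v, N v -> exists x, K (v - f x)) ->
  quot_card N K #|X|.
Proof.
move=> Nf fi fs; exists (f \o enum_val); split=> [x|x y /fi/enum_val_inj //|v Nv].
  exact: Nf.
by have [x Kx] := fs v Nv; exists (enum_rank x); rewrite /= enum_rankK.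
Qed.

Section Subgroups.
Variables (V : zmodType) (K : set V).
Hypothesis sgK : subgroup K.

Lemma subgroup0 : K 0. Proof. by case: sgK. Qed.
Lemma subgroupB x y : K x -> K y -> K (x - y). Proof. by case: sgK => _; apply. Qed.
Lemma subgroupN x : K x -> K (- x).
Proof. by move=> Kx; rewrite -sub0r; apply: subgroupB => //; apply: subgroup0. Qed.
Lemma subgroupD x y : K x -> K y -> K (x + y).
Proof. by move=> Kx Ky; rewrite -[y]opprK; apply/subgroupB/subgroupN. Qed.
Lemma subgroup_sum (I : Type) (r : seq I) (P : pred I) (F : I -> V) :
  (forall i, P i -> K (F i)) -> K (\sum_(i <- r | P i) F i).
Proof. by move=> h; apply: big_ind => //; [exact: subgroup0|exact: subgroupD]. Qed.
Lemma subgroupMn x n : K x -> K (x *+ n).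
Proof.
move=> Kx; elim: n => [|n IHn]; first exact: subgroup0.
by rewrite mulrS; apply: subgroupD.
Qed.
Lemma subgroup_trans x y z : K (x - y) -> K (y - z) -> K (x - z).
Proof. by move=> Kxy Kyz; rewrite -(subrKA y); apply: subgroupD. Qed.
Lemma subgroup_sym x y : K (x - y) -> K (y - x).
Proof. by move=> Kxy; rewrite -opprB; apply: subgroupN. Qed.
End Subgroups.

Lemma submodule_sum V (N : set V) (B : Type) (r : seq B) (P : pred B)
    (c : B -> Zl l) (g : B -> V) :
  submodule N -> (forall b, N (g b)) -> N (\sum_(b <- r | P b) c b *: g b).
Proof. by move=> [sN NZ] Ng; apply: subgroup_sum => // b _; apply: NZ. Qed.

Lemma zspan_submodule V (B : finType) (g : B -> V) : submodule (zspan g).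
Proof.
split; [split|].
- by exists (fun=> 0); rewrite big1 // => b _; rewrite scale0r.
- move=> _ _ [c ->] [d ->]; exists (fun b => c b - d b).
  by rewrite -sumrB; apply: eq_bigr => b _; rewrite scalerBl.
- move=> a _ [c ->]; exists (fun b => a * c b); rewrite scaler_sumr.
  by apply: eq_bigr => b _; rewrite scalerA.
Qed.

Lemma zspan_mem V (B : finType) (g : B -> V) b : zspan g (g b).
Proof.
exists (fun b' => if b' == b then 1 else 0); rewrite (bigD1 b) //= eqxx scale1r.
by rewrite big1 ?addr0 // => b' /negPf ->; rewrite scale0r.
Qed.

Lemma fin_gen_submodule V (N : set V) : fin_gen N -> submodule N.
Proof. by move=> [B [g ->]]; apply: zspan_submodule. Qed.

Lemma fin_gen_ord V (N : set V) : fin_gen N ->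
  exists k (g : 'I_k -> V), (forall i, N (g i)) /\
    forall y, N y -> exists c : 'I_k -> Zl l, y = \sum_i c i *: g i.
Proof.
move=> [B [g ->]]; exists #|B|, (g \o enum_val); split=> [i|_ [c ->]].
  exact: zspan_mem.
exists (c \o enum_val); rewrite (reindex (@enum_val B predT)) //.
by apply: onW_bij; apply: enum_val_bij.
Qed.

Lemma quot_card_inj (V : zmodType) (N K : set V) q (Y : finType) (h : Y -> V) :
    subgroup K -> quot_card N K q -> (forall y, N (h y)) ->
  (forall y z, K (h y - h z) -> y = z) -> (#|Y| <= q)%N.
Proof.
move=> sK [f [_ _ fsurj]] Nh hinj; rewrite -[q]card_ord.
have /choice[r hr] y : exists x, K (h y - f x) by exact: fsurj.
apply: (leq_card r) => y z ryz; apply: hinj.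
apply: (subgroup_trans sK (hr y)); rewrite ryz; exact: (subgroup_sym sK (hr z)).
Qed.

Lemma quot_card_unique (V : zmodType) (N K : set V) q q' : subgroup K ->
  quot_card N K q -> quot_card N K q' -> q = q'.
Proof.
move=> sK qN qN'; apply/eqP; rewrite eqn_leq; apply/andP; split.
  by case: qN => f [Nf finj _]; rewrite -[q]card_ord; apply: quot_card_inj qN' Nf finj.
by case: qN' => f [Nf finj _]; rewrite -[q']card_ord; apply: quot_card_inj qN Nf finj.
Qed.

(** Sums of representatives of N / K and of K / K' represent N / K'. *)
Lemma quot_card_tower (V : zmodType) (N K K' : set V) q q' :
    subgroup N -> subgroup K -> subgroup K' -> K `<=` N -> K' `<=` K ->
  quot_card N K q -> quot_card K K' q' -> quot_card N K' (q * q').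
Proof.
move=> sN sK sK' KN KK' [f [Nf fi fs]] [f' [Kf' fi' fs']].
rewrite -[q]card_ord -[q']card_ord -card_prod.
apply: (@quot_card_intro _ _ _ _ (fun x => f x.1 + f' x.2)).
- by move=> [x x'] /=; apply: subgroupD => //; apply: KN.
- move=> [x x'] [y y'] /=; rewrite opprD addrACA => xy.
  have xy1 : x = y.
    apply: fi; rewrite -[_ - _](addrK (f' x' - f' y')).
    by apply: subgroupB => //; [apply: KK'|apply: subgroupB].
  by move: xy; rewrite xy1 subrr add0r => /fi' ->.
- move=> v Nv; have [x xv] := fs v Nv; have [x' xv'] := fs' _ xv.
  by exists (x, x'); rewrite /= opprD addrA.
Qed.

(** A generating family of N modulo K of minimal size is a basis modulo l: an
    element whose coefficient in a relation is invertible could be left out. *)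
Lemma minimal_generators V (N K : set V) : fin_gen N -> submodule K ->
  exists k (g : 'I_k -> V), [/\ forall i, N (g i),
    forall y, N y -> exists c : 'I_k -> Zl l, K (y - \sum_i c i *: g i) &
    forall c : 'I_k -> Zl l, K (\sum_i c i *: g i) -> forall i, c i 0%N = 0].
Proof.
move=> fgN [sK KZ].
pose gen k := exists g : 'I_k -> V, (forall i, N (g i)) /\
  forall y, N y -> exists c : 'I_k -> Zl l, K (y - \sum_i c i *: g i).
pose P k := `[< gen k >].
have [k0 gen0] : exists k, P k.
  have [k [g [Ng gN]]] := fin_gen_ord fgN.
  exists k; apply/asboolP; exists g; split=> // y /gN[c ->]; exists c.
  by rewrite subrr; apply: subgroup0.
have [k /asboolP[g [Ng gN]] k_min] := ex_minnP (ex_intro (fun k => P k) k0 gen0).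
exists k, g; split=> // c Kc i; apply/eqP/negPn/negP => ci.
have [u uc] := Zl_unit l_prime ci.
case: k g Ng gN k_min c i Kc ci uc => [|k] g Ng gN k_min c i Kc ci uc.
  by case: i ci uc.
suff /k_min : P k by rewrite ltnn.
apply/asboolP; exists (fun j => g (lift i j)); split=> [j|y /gN[d Kd]]; first exact: Ng.
pose e j := d j - d i * u * c j.
have ei : e i = 0 by rewrite /e -mulrA uc mulr1 subrr.
exists (fun j => e (lift i j)).
have -> : \sum_j e (lift i j) *: g (lift i j) =
          \sum_j d j *: g j - (d i * u) *: \sum_j c j *: g j.
  transitivity (\sum_j e j *: g j).
    by rewrite [RHS](bigD1_ord i) //= ei scale0r add0r.
  rewrite scaler_sumr -sumrB; apply: eq_bigr => j _.
  by rewrite scalerA -scalerBl.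
by rewrite opprB addrA addrAC; apply: subgroupD => //; apply: KZ.
Qed.

Definition l_multiples (V : zmodType) (N : set V) : set V := [set y *+ l | y in N].

(** The elements whose class modulo torsion is in l N. For x in N, membership says
    that x is zero in T / l T, where T is N modulo its torsion. *)
Definition l_multiples_tors (V : zmodType) (N : set V) : set V :=
  [set x | exists m, exists2 y, N y & x *+ l ^ m = y *+ l ^ m.+1].

Definition l_torsion (V : zmodType) : set V := [set x | exists m, x *+ l ^ m = 0].

Lemma scale_lX V (x : V) m : l%:R ^+ m *: x = x *+ l ^ m.
Proof. by rewrite -natrX scaler_nat. Qed.

Lemma l_torsion_submodule V : submodule (@l_torsion V).
Proof.
split; [split|].
- by exists 0%N; rewrite mul0rn.
- move=> x y [m xm] [n yn]; exists (m + n)%N.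
  rewrite mulrnBl [in x *+ _]expnD mulrnA xm mul0rn.
  by rewrite addnC expnD mulrnA yn mul0rn subrr.
- by move=> c x [m xm]; exists m; rewrite scalerMnr xm scaler0.
Qed.

Lemma l_multiples_submodule V (N : set V) : submodule N -> submodule (l_multiples N).
Proof.
move=> [sN NZ]; split; [split|].
- by exists 0; [exact: subgroup0|rewrite mul0rn].
- move=> _ _ [x Nx <-] [y Ny <-]; exists (x - y); first exact: subgroupB.
  by rewrite mulrnBl.
- by move=> c _ [x Nx <-]; exists (c *: x); [exact: NZ|rewrite scalerMnr].
Qed.

Lemma l_multiples_tors_submodule V (N : set V) :
  submodule N -> submodule (l_multiples_tors N).
Proof.
move=> [sN NZ]; split; [split|].
- by exists 0%N, 0; [exact: subgroup0|rewrite !mul0rn].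
- move=> x y [m [x' Nx' xx']] [n [y' Ny' yy']].
  exists (m + n)%N, (x' - y'); first exact: subgroupB.
  rewrite !mulrnBl; congr (_ - _).
    by rewrite expnD mulrnA xx' -mulrnA -expnD.
  by rewrite addnC expnD mulrnA yy' -mulrnA -expnD.
- move=> c x [m [y Ny xy]]; exists m, (c *: y); first exact: NZ.
  by rewrite !scalerMnr xy.
Qed.

(** The combinations of the g i with coefficients in {0, ..., l - 1} represent
    N / K. *)
Lemma quot_card_basis V (N K : set V) k (g : 'I_k -> V) :
    submodule N -> submodule K -> l_multiples N `<=` K -> (forall i, N (g i)) ->
    (forall y, N y -> exists c : 'I_k -> Zl l, K (y - \sum_i c i *: g i)) ->
    (forall c : 'I_k -> Zl l, K (\sum_i c i *: g i) -> forall i, c i 0%N = 0) ->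
  quot_card N K (l ^ k).
Proof.
move=> mN mK lNK Ng gN gK; have sK := mK.1.
have -> : (l ^ k = #|{ffun 'I_k -> 'F_l}|)%N by rewrite card_ffun card_Fp // card_ord.
apply: (@quot_card_intro _ _ _ _
  (fun c : {ffun 'I_k -> 'F_l} => \sum_i ((c i : nat)%:R : Zl l) *: g i)).
- by move=> c; apply: submodule_sum.
- move=> c d; rewrite -sumrB.
  under eq_bigr do rewrite -scalerBl.
  move=> /gK cd; apply/ffunP => i; apply: val_inj.
  have := cd i; rewrite -[LHS]/((_%:R : Zl l) 0%N - (_%:R : Zl l) 0%N) => /eqP.
  rewrite subr_eq0 => /eqP/(congr1 (fun x : 'Z_(l ^ 1) => x : nat)).
  rewrite !Zl_natE_val // !modn_small // ?expn1.
    by apply: leq_trans (ltn_ord (d i)) _; rewrite Fp_cast.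
  by apply: leq_trans (ltn_ord (c i)) _; rewrite Fp_cast.
- move=> y /gN[a Ka].
  have /choice[c /choice[r cr]] i : exists c : 'F_l, exists r,
      a i = (c : nat)%:R + l%:R * r.
    exact: Zl_residue.
  exists [ffun i => c i]; apply: (subgroup_trans sK Ka).
  rewrite -sumrB; apply: lNK; exists (\sum_i r i *: g i); first exact: submodule_sum.
  rewrite -sumrMnl; apply: eq_bigr => i _.
  by rewrite ffunE -scalerBl cr addrAC subrr add0r -scalerA scaler_nat.
Qed.

Lemma Fl_subK (a b : 'F_l) : exists t, (((a - b)%R : 'F_l) + b = a + l * t)%N.
Proof.
exists ((((a - b)%R : 'F_l) + b) %/ l)%N.
rewrite [LHS](divn_eq _ l) addnC mulnC; congr (_ + _)%N.
transitivity ((a - b + b)%R : nat); last by rewrite subrK.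
by congr modn; rewrite Fp_cast.
Qed.

(** A minimal system of generators is a basis of N / l N over 'F_l, and a family of
    j elements independent modulo l N has l ^ j combinations, which are distinct
    elements of N / l N. *)
Lemma l_rank_of_quot_card V (N : set V) : fin_gen N ->
  exists k, quot_card N (l_multiples N) (l ^ k) /\
    max_nat [set j | exists x : 'I_j -> V, (forall i, N (x i)) /\
      forall c : 'I_j -> 'F_l,
        [set y *+ l | y in N] (\sum_i x i *+ (c i : nat)) ->
        forall i, c i = 0] = k.
Proof.
move=> fgN; have mN := fin_gen_submodule fgN.
have mK := l_multiples_submodule mN.
have [k [g [Ng gN gK]]] := minimal_generators fgN mK.
have qN := quot_card_basis mN mK (@subset_refl _ _) Ng gN gK.
exists k; split=> //; apply: max_nat_eq.
  exists g; split=> // c; under eq_bigr do rewrite -scaler_nat.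
  move=> /gK ci i; have := ci i => /(congr1 (fun x : 'Z_(l ^ 1) => x : nat)).
  rewrite Zl_natE_val // modn_small => [ci0|]; first exact: val_inj.
  by rewrite expn1; apply: leq_trans (ltn_ord (c i)) _; rewrite Fp_cast.
move=> j [x [Nx xK]].
rewrite -(leq_exp2l _ _ (prime_gt1 l_prime)) -[X in (X ^ j)%N]card_Fp //.
rewrite -[j]card_ord -card_ffun.
apply: (quot_card_inj mK.1 qN
  (h := fun c : {ffun 'I_j -> 'F_l} => \sum_i x i *+ (c i : nat))).
  by move=> c; apply: (subgroup_sum mN.1) => i _; apply: (subgroupMn mN.1).
move=> c d cd; apply/eqP; rewrite -subr_eq0; apply/eqP/ffunP => i; rewrite [RHS]ffunE.
rewrite -[LHS]/((c - d) i); move: i; apply: (xK (c - d)).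
have /choice[t tE] i := Fl_subK (c i) (d i).
rewrite -[\sum_i x i *+ _](subrK (\sum_i x i *+ (c i : nat) - \sum_i x i *+ (d i : nat))).
apply: (subgroupD mK.1) cd; exists (\sum_i x i *+ t i).
  by apply: (subgroup_sum mN.1) => i _; apply: (subgroupMn mN.1).
rewrite -sumrB -sumrB -sumrMnl; apply: eq_bigr => i _.
rewrite !ffunE opprB addrA -mulrnDr tE mulrnDr [_ *+ c i + _]addrC addrK.
by rewrite mulnC mulrnA.
Qed.

End ZlModules.

(** * Counting with a free action *)

(** The size of an orbit divides p ^ n.+1, and if it is smaller then
    s ^ (p ^ n) fixes the orbit: all the orbits but {x0} have p ^ n.+1 elements. *)
Lemma perm_free_card (X : finType) (s : {perm X}) x0 p n : prime p ->
    s x0 = x0 -> (s ^+ (p ^ n.+1) = 1)%g ->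
    (forall x, (s ^+ (p ^ n))%g x = x -> x = x0) ->
  (#|X| = 1 %[mod p ^ n.+1])%N.
Proof.
move=> p_pr sx0 s1 s_free.
have orb x : x != x0 -> (p ^ n.+1 %| #|orbit 'P <[s]> x|)%N.
  move=> x_neq; have [|j] := @dvdn_pfactor p #|orbit 'P <[s]> x| n.+1 p_pr _.
    by apply: dvdn_trans (dvdn_orbit _ _ _) _; rewrite -orderE order_dvdn s1.
  rewrite leq_eqVlt => /predU1P[-> -> //|]; rewrite ltnS => jn jE.
  case/eqP: x_neq; apply: s_free; rewrite -(subnKC jn) expnD expgM permX.
  have : (s ^+ (p ^ j))%g x = x.
    rewrite permX -jE.
    have -> : orbit 'P <[s]> x = porbit s x by rewrite porbitE.
    exact: iter_porbit.
  by move=> sjx; elim: (p ^ _)%N => // k; rewrite iterS => ->.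
have acts : ([acts <[s]>, on [set~ x0]%SET | 'P])%g.
  rewrite cycle_subG; apply/astabsP => x; rewrite !inE /= /aperm.
  by rewrite -{1}sx0 (inj_eq perm_inj).
have -> : #|X| = (\sum_(T in [set orbit 'P <[s]> x | x in [set~ x0]]%SET) #|T| + 1)%N.
  by rewrite acts_sum_card_orbit // cardsC1 addn1 prednK //; apply/card_gt0P; exists x0.
apply/eqP; rewrite eqn_mod_dvd ?leq_addl // addnK; apply: dvdn_sum => A /imsetP[x].
by rewrite !inE => x_neq ->; apply: orb.
Qed.

Section NaturalSubmodules.
Variable l : nat.
Hypothesis l_prime : prime l.

(** A submodule of N that depends functorially on N. The three invariants of the
    theorem are the logarithms of |N / K N| for three such K: the multiples of l,
    those modulo torsion, and 0. *)
Definition natural_submodule (K : forall V : lmodType (Zl l), set V -> set V) :=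
  (forall (V : lmodType (Zl l)) (N : set V), submodule N -> submodule (K V N)) /\
  forall (V W : lmodType (Zl l)) (f : {linear V -> W}) (N : set V) (N' : set W),
    (forall x, N x -> N' (f x)) -> forall x, K V N x -> K W N' (f x).

Lemma l_multiples_natural : natural_submodule (fun V N => l_multiples l N).
Proof.
split=> [V N|V W f N N' fN _ [y Ny <-]]; first exact: l_multiples_submodule.
by exists (f y); [exact: fN|rewrite raddfMn].
Qed.

Lemma l_multiples_tors_natural : natural_submodule (fun V N => l_multiples_tors l N).
Proof.
split=> [V N|V W f N N' fN x [m [y Ny xy]]]; first exact: l_multiples_tors_submodule.
by exists m, (f y); [exact: fN|rewrite -!raddfMn xy].
Qed.

Lemma zero_submodule (V : lmodType (Zl l)) : submodule ([set 0] : set V).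
Proof.
split; [split=> [|x y /= -> ->]|move=> c x /= ->] => //=; first by rewrite subrr.
by rewrite scaler0.
Qed.

Lemma zero_natural : natural_submodule (fun V N => [set 0]).
Proof.
split=> [V N _|V W f N N' _ x /= ->]; first exact: zero_submodule.
by rewrite raddf0.
Qed.

(** Each nonzero element of N / K has p ^ n.+1 translates by the powers of T: if
    T ^ (p ^ n) fixes the class of x, then p x = 0 in N / K, where p is
    invertible. *)
Lemma quot_card_free (K : forall V : lmodType (Zl l), set V -> set V)
    (V : lmodType (Zl l)) (N : set V) (T : {linear V -> V}) p n q :
    natural_submodule K -> prime p -> l != p -> submodule N ->
    (forall x, N x -> N (T x)) ->
    (forall x, N x -> iter (p ^ n.+1) T x = x) ->
    (forall x, N x -> \sum_(i < p) iter (i * p ^ n) T x = 0) ->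
  quot_card N (K V N) q -> (q = 1 %[mod p ^ n.+1])%N.
Proof.
move=> [Ksub Knat] p_pr lp mN NT T1 Tsum [f [Nf fi fs]].
have mK := Ksub V N mN; have sK := mK.1.
have KT x : K V N x -> K V N (T x) by apply: Knat.
have KTi k x : K V N x -> K V N (iter k T x).
  by move=> Kx; elim: k => // k IHk; apply: KT.
have TiB k x y : iter k T (x - y) = iter k T x - iter k T y.
  by elim: k => // k IHk; rewrite !iterS IHk raddfB.
have /choice[t tE] x : exists y, K V N (T (f x) - f y) by apply: fs; apply: NT.
have tiE k x : K V N (iter k T (f x) - f (iter k t x)).
  elim: k => [|k IHk]; first by rewrite subrr; apply: subgroup0.
  rewrite !iterS; apply: (subgroup_trans sK _ (tE _)).
  by rewrite -raddfB; apply: KT.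
have t_inj : injective t.
  move=> x y txy; apply: fi.
  have : K V N (T (f x) - T (f y)).
    by apply: (subgroup_trans sK (tE x)); rewrite txy; apply: (subgroup_sym sK).
  rewrite -raddfB => /(KTi (p ^ n.+1).-1).
  by rewrite -iterSr prednK ?expn_gt0 ?prime_gt0 // TiB !T1.
pose s := perm t_inj.
have sX k x : (s ^+ k)%g x = iter k t x.
  by rewrite permX; apply: eq_iter => y; rewrite permE.
have [x0 Kx0] := fs 0 (subgroup0 mN.1).
have {Kx0}Kx0 : K V N (f x0) by rewrite -[f x0]subr0; apply: subgroup_sym.
have eq_x0 x : K V N (f x) -> x = x0 by move=> Kx; apply: fi; apply: subgroupB.
rewrite -[q]card_ord; apply: (@perm_free_card _ s x0) => //.
- rewrite permE; apply: eq_x0; rewrite -[f _](subKr (T (f x0))).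
  by apply: subgroupB => //; apply: KT.
- apply/permP => x; rewrite sX perm1; apply: fi; apply: subgroup_sym => //.
  by rewrite -[X in X - _]T1.
- move=> x; rewrite sX => sx; apply: eq_x0.
  have Ku i : K V N (iter (i * p ^ n) T (f x) - f x).
    have -> : f x = f (iter (i * p ^ n) t x).
      by congr f; elim: i => // i IHi; rewrite mulSn iterD -IHi.
    have {2}-> : x = iter (i * p ^ n) t x.
      by elim: i => // i IHi; rewrite mulSn iterD -IHi.
    exact: tiE.
  have [u up1] : exists u : Zl l, u * p%:R = 1.
    by apply: Zl_unit_coprime; rewrite // prime_coprime // dvdn_prime2.
  rewrite -[f x]scale1r -up1 -scalerA scaler_nat; apply: mK.2.
  rewrite -[_ *+ _]subr0 -(Tsum _ (Nf x)) -[X in _ *+ X]card_ord -sumr_const -sumrB.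
  by apply: subgroup_sum => // i _; apply: subgroup_sym.
Qed.

(** * Direct sums, ranks and lengths *)

(** With W = V and the identity for inj j, this is an internal direct sum; with V the
    functions from J to W, an external one. Both occur below. *)
Record direct_sum_decomposition (V W : lmodType (Zl l)) (J : finType) (N : set V)
    (Nj : J -> set W) (inj : J -> {linear W -> V}) (prj : J -> {linear V -> W}) :
    Prop := DirectSumDecomposition {
  dsum_inj : forall j x, Nj j x -> N (inj j x);
  dsum_prj : forall j x, N x -> Nj j (prj j x);
  dsum_prjK : forall x, N x -> \sum_j inj j (prj j x) = x;
  dsum_injK : forall i j x, Nj i x -> prj j (inj i x) = if i == j then x else 0 }.

Section DirectSum.
Variables (V W : lmodType (Zl l)) (J : finType) (N : set V) (Nj : J -> set W).
Variables (inj : J -> {linear W -> V}) (prj : J -> {linear V -> W}).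
Hypothesis sumN : direct_sum_decomposition N Nj inj prj.
Hypothesis mN : submodule N.

Lemma quot_card_direct_sum K q : natural_submodule K ->
  (forall j, quot_card (Nj j) (K W (Nj j)) (q j)) ->
  quot_card N (K V N) (\prod_j q j).
Proof.
move=> [Ksub Knat] qN; pose f j := sval (cid (qN j)).
have fE j : [/\ forall x, Nj j (f j x),
    forall x y, K W (Nj j) (f j x - f j y) -> x = y &
    forall v, Nj j v -> exists x, K W (Nj j) (v - f j x)] := svalP (cid (qN j)).
have mK := Ksub V N mN.
have -> : (\prod_j q j = #|{dffun forall j : J, 'I_(q j)}|)%N.
  rewrite card_dep_ffun foldrE big_map big_enum /=.
  by apply: eq_bigr => j _; rewrite card_ord.
have Nf j x : Nj j (f j x) by have [h _ _] := fE j; apply: h.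
have prjE (x : {dffun forall j : J, 'I_(q j)}) j :
    prj j (\sum_i inj i (f i (x i))) = f j (x j).
  rewrite raddf_sum (bigD1 j) //= (dsum_injK sumN) // eqxx big1 ?addr0 // => i /negPf ij.
  by rewrite (dsum_injK sumN) // ij.
apply: (@quot_card_intro _ _ _ _
  (fun x : {dffun forall j : J, 'I_(q j)} => \sum_j inj j (f j (x j)))).
- by move=> x; apply: (subgroup_sum mN.1) => j _; apply: (dsum_inj sumN).
- move=> x y Kxy; apply/ffunP => j; have [_ fi _] := fE j; apply: fi.
  by rewrite -!prjE -raddfB; apply: Knat Kxy => z; apply: (dsum_prj sumN).
- move=> v Nv.
  have h j : {x : 'I_(q j) | K W (Nj j) (prj j v - f j x)}.
    by apply: cid; have [_ _ fs] := fE j; apply: fs; apply: (dsum_prj sumN).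
  exists [ffun j : J => sval (h j)].
  rewrite -{1}(dsum_prjK sumN Nv) -sumrB; apply: (subgroup_sum mK.1) => j _.
  rewrite ffunE -raddfB; apply: Knat (svalP (h j)) => x.
  exact: (dsum_inj sumN).
Qed.

Lemma fin_gen_direct_sum : (forall j, fin_gen (Nj j)) -> fin_gen N.
Proof.
move=> fgN.
pose B j := sval (cid (fgN j)).
have gE' j : exists g : B j -> W, Nj j = zspan g := svalP (cid (fgN j)).
pose g j := sval (cid (gE' j)).
have gE j : Nj j = zspan (g j) := svalP (cid (gE' j)).
exists {j : J & B j}, (fun s => inj (tag s) (g (tag s) (tagged s))).
apply/seteqP; split=> [y Ny|_ [c ->]]; last first.
  apply: submodule_sum => // -[j i] /=; apply: (dsum_inj sumN); rewrite gE.
  exact: zspan_mem.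
have cE' j : exists c : B j -> Zl l, prj j y = \sum_b c b *: g j b.
  by have := dsum_prj sumN j Ny; rewrite gE.
pose c j := sval (cid (cE' j)).
have cE j : prj j y = \sum_b c j b *: g j b := svalP (cid (cE' j)).
exists (fun s => c (tag s) (tagged s)); rewrite -{1}(dsum_prjK sumN Ny).
under eq_bigr do rewrite cE raddf_sum.
rewrite sig_big_dep; apply: eq_bigr => -[j b] _ /=.
by rewrite linearZ.
Qed.
End DirectSum.

(** The torsion-free quotient of N is free: a relation between a minimal number of
    generators can be divided by a power of l, and then has an invertible
    coefficient, against minimality. The same generators are a basis modulo l of
    this quotient. *)
Lemma basis_mod_torsion (V : lmodType (Zl l)) (N : set V) : fin_gen N ->
  exists k (g : 'I_k -> V), [/\ forall i, N (g i),
    forall y, N y -> exists c : 'I_k -> Zl l, l_torsion l (y - \sum_i c i *: g i),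
    forall c : 'I_k -> Zl l, \sum_i c i *: g i = 0 -> forall i, c i = 0 &
    quot_card N (l_multiples_tors l N) (l ^ k)].
Proof.
move=> fgN; have mN := fin_gen_submodule fgN.
have mT := l_torsion_submodule V.
have [k [g [Ng gN gT]]] := minimal_generators l_prime fgN mT.
exists k, g; split=> //.
- move=> c cg i; apply: contrapT => ci0.
  have [|n [d [j [dj cE]]]] := @Zl_factor_family l l_prime _ c; first by exists i.
  case/eqP: dj; apply: gT; exists n.
  rewrite -scale_lX scaler_sumr -[RHS]cg; apply: eq_bigr => j' _.
  by rewrite scalerA cE.
- apply: quot_card_basis => //.
  + exact: l_multiples_tors_submodule.
  + by move=> _ [y Ny <-]; exists 0%N, y.
  + move=> y /gN[c [m cT]]; exists c, m, 0; last by rewrite mul0rn.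
    exact: (subgroup0 mN.1).
  + move=> c [m [z Nz czE]] i; have [d [n dT]] := gN z Nz.
    suff : (c i - l%:R * d i) 0%N = 0.
      rewrite -[LHS]/(c i 0%N - (l%:R * d i : Zl l) 0%N).
      have -> : (l%:R * d i : Zl l) 0%N = 0; last by rewrite subr0.
      by apply: val_inj; rewrite [LHS]Zl_mul_val // Zl_natE_val // modnn mul0n mod0n.
    apply: (gT (fun j => c j - l%:R * d j)); exists (m + n)%N.
    have -> : \sum_j (c j - l%:R * d j) *: g j =
              \sum_j c j *: g j - (\sum_j d j *: g j) *+ l.
      rewrite -sumrMnl -sumrB; apply: eq_bigr => j _.
      by rewrite scalerBl -scalerA scaler_nat.
    have -> : \sum_j d j *: g j = z - (z - \sum_j d j *: g j) by rewrite subKr.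
    have dT' : (z - \sum_j d j *: g j) *+ (l * l ^ (m + n)) = 0.
      by rewrite mulnC addnC expnD -mulnA mulrnA dT mul0rn.
    rewrite mulrnBl -mulrnA mulrnBl dT' subr0 expnD mulrnA czE -mulrnA.
    by rewrite expnS mulnA subrr.
Qed.

(** Modulo torsion N is generated by k elements, so that more than k elements of N
    satisfy a relation, multiplied by a power of l that annihilates the torsion
    involved. *)
Lemma Zl_rank_of_quot_card (V : lmodType (Zl l)) (N : set V) : fin_gen N ->
  exists k, quot_card N (l_multiples_tors l N) (l ^ k) /\
    max_nat [set j | exists x : 'I_j -> V, (forall i, N (x i)) /\
      forall c : 'I_j -> Zl l, \sum_i c i *: x i = 0 -> forall i, c i = 0] = k.
Proof.
move=> fgN; have [k [g [Ng gN g_free qN]]] := basis_mod_torsion fgN.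
exists k; split=> //; apply: max_nat_eq; first by exists g.
move=> j [x [Nx x_free]]; rewrite leqNgt; apply/negP => kj.
have /choice[A /choice[m mE]] i := gN _ (Nx i).
have [c [[i0 ci0] cA]] :=
  linear_dependence (@Zl_one_neq0 l) (@Zl_integral l l_prime) A kj.
apply: ci0; pose s := (\sum_i m i)%N.
apply: (@Zl_mullX_inj l l_prime s).
apply: (x_free (fun i => l%:R ^+ s * c i)).
have xE i : l%:R ^+ s *: x i = l%:R ^+ s *: \sum_i' A i i' *: g i'.
  apply/eqP; rewrite -subr_eq0 -scalerBr scale_lX /s (bigD1 i) //= expnD mulrnA.
  by rewrite mE mul0rn.
under eq_bigr do rewrite mulrC -scalerA xE scaler_sumr scaler_sumr.
rewrite exchange_big big1 // => i' _ /=.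
rewrite -[RHS](scale0r (l%:R ^+ s *: g i')) -(cA i') scaler_suml.
by apply: eq_bigr => i _; rewrite !scalerA mulrAC.
Qed.

Lemma torsion_exponent (V : lmodType (Zl l)) (N : set V) : fin_gen N ->
  N `<=` @l_torsion l V -> exists e, forall x, N x -> x *+ l ^ e = 0.
Proof.
move=> /fin_gen_ord[k [g [Ng gN]]] NT.
have /choice[m mE] i := NT _ (Ng i).
exists (\sum_i m i)%N => x /gN[c ->].
rewrite -sumrMnl big1 // => i _; rewrite scalerMnr (bigD1 i) //= expnD mulrnA.
by rewrite mE mul0rn scaler0.
Qed.

Lemma fin_gen_l_multiples (V : lmodType (Zl l)) (N : set V) :
  fin_gen N -> fin_gen (l_multiples l N).
Proof.
move=> [B [g ->]]; exists B, (fun b => g b *+ l).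
apply/seteqP; split=> [_ [_ [c ->] <-]|_ [c ->]].
  by exists c; rewrite -sumrMnl; apply: eq_bigr => b _; rewrite scalerMnr.
exists (\sum_b c b *: g b); first by exists c.
by rewrite -sumrMnl; apply: eq_bigr => b _; rewrite scalerMnr.
Qed.

(** A finitely generated torsion module is filtered by the l ^ i N, with
    quotients that are vector spaces over 'F_l. *)
Lemma quot_card_torsion (V : lmodType (Zl l)) (N : set V) : fin_gen N ->
  N `<=` @l_torsion l V -> exists v, quot_card N [set 0] (l ^ v).
Proof.
move=> fgN /(torsion_exponent fgN)[e]; elim: e N fgN => [|e IHe] N fgN Ne.
  exists 0%N, (fun=> 0); have mN := fin_gen_submodule fgN; split=> [_|x y _|v Nv].
  - exact: subgroup0 mN.1.
  - by rewrite !ord1.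
  - by exists ord0; rewrite subr0 /= -[v]mulr1n; apply: Ne.
have [k [qN _]] := l_rank_of_quot_card l_prime fgN.
have fglN := fin_gen_l_multiples fgN.
have [v qlN] : exists v, quot_card (l_multiples l N) [set 0] (l ^ v).
  by apply: IHe => // _ [y Ny <-]; rewrite -mulrnA -expnS; apply: Ne.
have mN := fin_gen_submodule fgN; have mlN := fin_gen_submodule fglN.
exists (k + v)%N; rewrite expnD; apply: quot_card_tower qN qlN => //.
- exact: mN.1.
- exact: mlN.1.
- exact: (zero_submodule V).1.
- by move=> _ [y Ny <-]; apply: (subgroupMn mN.1).
- by move=> _ ->; apply: (subgroup0 mlN.1).
Qed.

Lemma quot_card_fset_set (V : zmodType) (N : set V) q : quot_card N [set 0] q ->
  finite_set N /\ #|` fset_set N| = q.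
Proof.
move=> [f [Nf fi fs]].
have Nq : (N #= `I_q)%card.
  rewrite card_eq_sym; apply: (card_eq_trans card_II); rewrite card_eq_sym.
  have -> : N = f @` [set: 'I_q].
    apply/seteqP; split=> [v Nv|_ [x _ <-] //].
    by have [x /subr0_eq->] := fs v Nv; exists x.
  apply: inj_card_eq => x y _ _ fxy; apply: fi; rewrite fxy subrr //.
split; last exact: card_fset_set.
by exists q.
Qed.

End NaturalSubmodules.

(** * The order of l modulo the powers of p *)

Definition order_mod (l N d : nat) :=
  (0 < d)%N /\ forall k, (l ^ k == 1 %[mod N])%N = (d %| k)%N.

Section OrderMod.
Local Open Scope nat_scope.

Lemma order_mod_exists l N : coprime l N -> exists d, order_mod l N d.
Proof.
move=> coNl; have ex : exists d, (0 < d) && (l ^ d == 1 %[mod N]).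
  case: N coNl => [|N] coNl.
    by exists 1; move: coNl; rewrite /coprime gcdn0 => /eqP->.
  by exists (totient N.+1); rewrite totient_gt0 Euler_exp_totient ?eqxx.
have [d /andP[d0 /eqP ld] d_min] := ex_minnP ex.
exists d; split=> // k; apply/eqP/idP => [lk|/dvdnP[q ->]]; last first.
  by rewrite mulnC expnM -modnXm ld modnXm exp1n.
have lr : l ^ (k %% d) == 1 %[mod N].
  have lq : (l ^ d) ^ (k %/ d) = 1 %[mod N] by rewrite -modnXm ld modnXm exp1n.
  rewrite (divn_eq k d) (mulnC _ d) expnD expnM -modnMml lq modnMml mul1n in lk.
  exact/eqP.
apply: contraT; rewrite /dvdn -lt0n => r0.
by have := d_min (k %% d); rewrite r0 lr leqNgt ltn_mod d0 => /(_ isT).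
Qed.

Lemma order_mod_dvd l N N' d d' : N %| N' ->
  order_mod l N d -> order_mod l N' d' -> d %| d'.
Proof.
move=> NN' [_ dE] [_ d'E]; rewrite -dE; have := d'E d'; rewrite dvdnn => /eqP h.
by apply/eqP; rewrite -(modn_dvdm _ NN') h modn_dvdm.
Qed.

Lemma order_mod_unique l N d d' : order_mod l N d -> order_mod l N d' -> d = d'.
Proof.
move=> h h'; apply/eqP; rewrite eqn_dvd.
by rewrite (order_mod_dvd (dvdnn N) h h') (order_mod_dvd (dvdnn N) h' h).
Qed.

(** x ^ p - 1 = (x - 1) (1 + x + ... + x ^ p.-1), where the second factor is
    congruent to p modulo p ^ 2. *)
Lemma logn_exp_prime p x : prime p -> 1 < x -> p %| x - 1 ->
    (p = 2 -> 4 %| x - 1) ->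
  logn p (x ^ p - 1) = (logn p (x - 1)).+1.
Proof.
move=> p_pr x1 px p2.
suff [W SE] : exists W, \sum_(i < p) x ^ i = p * (1 + p * W).
  have x10 : 0 < x.-1 by lia.
  have p0 := prime_gt0 p_pr.
  have logpp : logn p p = 1 by rewrite -{2}[p]expn1 pfactorK.
  have logW : logn p (1 + p * W) = 0.
    apply: logn_coprime; rewrite prime_coprime // dvdn_addl ?dvdn_mulr //.
    by rewrite dvdn1 neq_ltn prime_gt1 ?orbT.
  by rewrite !subn1 predn_exp SE !lognM ?muln_gt0 ?p0 // logpp logW addn1.
have [p_eq2|p_neq2] := eqVneq p 2.
  have /dvdnP[z xz] := p2 p_eq2; exists z.
  rewrite p_eq2 !big_ord_recl big_ord0 /= expn0 expn1 addn0.
  by rewrite -(subnK (ltnW x1)) xz; lia.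
have /dvdnP[z xz] := px; have {}xz : x = z * p + 1 by rewrite -xz subnK // ltnW.
have xi i : exists t, x ^ i = 1 + i * (z * p) + t * (p * p).
  elim: i => [|i [t IHi]]; first by exists 0; rewrite expn0 !mul0n.
  exists (i * z * z + t * x); rewrite expnSr IHi xz; nia.
have [t tE] := choice xi.
have /dvdnP[w wE] : p %| \sum_(i < p) i.
  have p_gt2 : 2 < p by have := prime_gt1 p_pr; move/eqP: p_neq2; lia.
  by rewrite -(big_mkord xpredT (fun i => i)) bin2_sum prime_dvd_bin.
exists (w * z + \sum_(i < p) t i).
under eq_bigr do rewrite tE.
rewrite !big_split /= sum1_card card_ord -!big_distrl /= wE; nia.
Qed.

Section PrimePowers.
Variables (l p : nat).
Hypotheses (l_prime : prime l) (p_prime : prime p).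
Variable f : nat -> nat.
Hypothesis fE : forall m, order_mod l (p ^ m) (f m).

(** Once l ^ D is close enough to 1, its p-th power is closer by exactly one
    factor p, so that the order is multiplied by p at each step. *)
Lemma order_mod_tower m0 D a : D = f m0 -> p %| l ^ D - 1 ->
    (p = 2 -> 4 %| l ^ D - 1) -> a = logn p (l ^ D - 1) -> m0 <= a ->
  forall m, m0 <= m -> f m = if m <= a then D else D * p ^ (m - a).
Proof.
move=> Df pD p2 aE m0a m m0m.
have D0 : 0 < D by rewrite Df; case: (fE m0).
have lX k : 0 < k -> 1 < l ^ k by move=> k0; rewrite -(expn0 l) ltn_exp2l // prime_gt1.
have logE i : logn p (l ^ (D * p ^ i) - 1) = a + i.
  elim: i => [|i IHi]; first by rewrite muln1 addn0.
  have pi0 : 0 < D * p ^ i by rewrite muln_gt0 D0 expn_gt0 prime_gt0.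
  have dv : l ^ D - 1 %| l ^ (D * p ^ i) - 1.
    by rewrite expnM !subn1 [X in _ %| X]predn_exp dvdn_mulr.
  rewrite expnSr mulnA expnM logn_exp_prime ?lX ?IHi ?addnS //.
    exact: dvdn_trans dv.
  by move=> /p2 h; apply: dvdn_trans dv.
have fdvd k i : 0 < i -> (f k %| i) = (k <= logn p (l ^ i - 1)).
  move=> i0; case: (fE k) => _ <-.
  by rewrite eqn_mod_dvd ?(ltnW (lX _ i0)) // pfactor_dvdn // subn_gt0 lX.
have Dm : D %| f m by rewrite Df; apply: order_mod_dvd (fE _) (fE _); apply: dvdn_exp2l.
case: leqP => [ma|am].
  by apply/eqP; rewrite eqn_dvd Dm fdvd // -aE ma.
have /dvdnP[k fk] := Dm.
have [|i im kE] := @dvdn_pfactor p k (m - a) p_prime _.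
  rewrite -(dvdn_pmul2r D0) -fk mulnC fdvd; last by rewrite muln_gt0 D0 expn_gt0 prime_gt0.
  by rewrite logE subnKC // ltnW.
rewrite fk kE mulnC; congr (D * p ^ _); apply/eqP; rewrite eqn_leq im leq_subLR.
rewrite -logE -fdvd; last by rewrite muln_gt0 D0 expn_gt0 prime_gt0.
by rewrite fk kE mulnC dvdnn.
Qed.

Lemma order_mod_pow0 : f 0 = 1.
Proof. by apply: order_mod_unique (fE 0) _; split=> // k; rewrite !modn1 dvd1n. Qed.

End PrimePowers.
End OrderMod.

(** * The formulas for the partial sums *)

Lemma sum_truncated (F : nat -> rat) n k B : (forall m, (n < m)%N -> F m = 0) ->
  (n < B)%N -> \sum_(k <= m < n.+1) F m = \sum_(k <= m < B) F m.
Proof.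
move=> F0 nB; have [kn|nk] := leqP k n.+1.
  rewrite (big_cat_nat kn nB) /=.
  have -> : \sum_(n.+1 <= m < B) F m = 0; last by rewrite addr0.
  by rewrite big_nat big1 // => m /andP[nm _]; apply: F0.
rewrite big_geq 1?ltnW // big_nat big1 // => m /andP[km _].
by apply: F0; apply: leq_trans km; apply: ltnW.
Qed.

(** The order of l modulo p ^ m stabilizes into a geometric progression of ratio p,
    starting from D = f 1, f 0 and f 2 in the three cases; terms beyond n may be
    added freely since the truncated sequence vanishes there. *)
Lemma layer_formulas_of_order l p (f : nat -> nat) (r : nat -> rat) n X :
    prime l -> prime p -> (forall m, order_mod l (p ^ m) (f m)) ->
    X = \sum_(0 <= m < n.+1) (f m)%:R * r m ->
  layer_formulas l p (a_const l p (f 1%N)) f r n X.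
Proof.
move=> l_pr p_pr fE XE; rewrite /layer_formulas; set a := a_const _ _ _.
set r' := omit_above n r; pose B := (n + a).+3.
have r'0 m : (n < m)%N -> r' m = 0 by rewrite /r' /omit_above ltnNge => /negPf ->.
have nB : (n < B)%N by rewrite /B; lia.
have aB : (a.+1 <= B)%N by rewrite /B; lia.
have f0 := order_mod_pow0 fE.
have XB : X = \sum_(0 <= m < B) (f m)%:R * r' m.
  rewrite -(@sum_truncated _ n); [|by move=> m /r'0->; rewrite mulr0|by []].
  rewrite XE big_nat [RHS]big_nat; apply: eq_bigr => m /andP[_]; rewrite ltnS => mn.
  by rewrite /r' /omit_above mn.
have tail q k : \sum_(k <= m < n.+1) (q ^ (m - a))%N%:R * r' m =
                \sum_(k <= m < B) (q ^ (m - a))%N%:R * r' m.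
  by apply: sum_truncated => // m /r'0->; rewrite mulr0.
have tower m0 D : D = f m0 -> (p %| l ^ D - 1)%N -> (p = 2 -> 4 %| l ^ D - 1)%N ->
    a = logn p (l ^ D - 1) -> (m0 <= a)%N ->
    \sum_(m0 <= m < B) (f m)%:R * r' m =
    D%:R * (\sum_(m0 <= m < a.+1) r' m
            + \sum_(a.+1 <= m < n.+1) (p ^ (m - a))%N%:R * r' m).
  move=> Df pD p2 aE m0a.
  have fm := order_mod_tower l_pr p_pr fE Df pD p2 aE m0a.
  rewrite (@big_cat_nat _ _ _ a.+1) //=; last exact: leqW.
  rewrite tail mulrDr !mulr_sumr; congr (_ + _); rewrite big_nat [RHS]big_nat.
    by apply: eq_bigr => m /andP[m0m ma]; rewrite fm // -ltnS ma.
  apply: eq_bigr => m /andP[am _].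
  have m0m : (m0 <= m)%N by rewrite (leq_trans m0a) // ltnW.
  by rewrite fm // leqNgt am natrM mulrA.
have lD m : (p ^ m %| l ^ f m - 1)%N.
  have [fm0 fmE] := fE m; rewrite -eqn_mod_dvd ?expn_gt0 ?prime_gt0 //.
  by rewrite fmE.
have lD0 m : (0 < l ^ f m - 1)%N.
  by rewrite subn_gt0 -(expn0 l) ltn_exp2l ?prime_gt1 //; case: (fE m).
split=> //.
- move=> /eqP p_neq2; rewrite XB big_ltn // f0 mul1r (tower 1%N (f 1%N)) //.
  + exact: lD 1%N.
  + by move/eqP: p_neq2.
  + by rewrite /a /a_const p_neq2.
  + by rewrite /a /a_const p_neq2 -pfactor_dvdn.
- move=> p_eq2 l1; have l_gt1 := prime_gt1 l_pr.
  rewrite XB (tower 0%N 1%N) ?mul1r ?p_eq2 //; rewrite ?expn1.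
  + by lia.
  + by move=> _; lia.
  + have l1' : (l %% 4 == 1)%N by lia.
    by rewrite /a /a_const p_eq2 /= l1'.
- move=> p_eq2 l3; have l_gt1 := prime_gt1 l_pr.
  have aE : a = logn 2 (l ^ 2 - 1).
    have l1 : (l %% 4 == 1)%N = false by lia.
    by rewrite /a /a_const p_eq2 /= l1.
  have f1 : f 1%N = 1%N.
    apply: order_mod_unique (fE 1%N) _; split=> // k; rewrite p_eq2 dvd1n -modnXm.
    have -> : (l %% 2 ^ 1 = 1)%N by lia.
    by rewrite exp1n eqxx.
  have f2 : f 2%N = 2%N.
    apply: order_mod_unique (fE 2%N) _; split=> // k; rewrite p_eq2 -modnXm.
    have -> : (l %% 2 ^ 2 = 3)%N by lia.
    rewrite dvdn2 -{1}(odd_double_half k) -mul2n expnD expnM -modnMmr -modnXm.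
    have -> : ((3 ^ 2) %% 2 ^ 2 = 1)%N by [].
    by rewrite exp1n modnMmr muln1; case: (odd k).
  rewrite XB big_ltn // big_ltn // f0 f1 !mul1r addrA (tower 2%N 2%N) ?p_eq2 //.
  + by have := lD 2%N; rewrite f2 p_eq2; apply: dvdn_trans.
  + by move=> _; have := lD 2%N; rewrite f2 p_eq2.
  + have := lD 2%N; have := lD0 2%N; rewrite f2 p_eq2 => h.
    by rewrite pfactor_dvdn // aE.
Qed.

(** * The degree of Q_l(mu_(p^n)) *)

Definition restrict_scalars (R S : pzRingType) (f : {rmorphism R -> S})
  (M : lmodType S) : Type := M.

Section RestrictScalars.
Variables (R S : pzRingType) (f : {rmorphism R -> S}) (M : lmodType S).
Local Notation N := (restrict_scalars f M).
HB.instance Definition _ := GRing.Zmodule.copy N M.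

Let scale (a : R) (x : N) : N := f a *: (x : M).
Let scaleA a b x : scale a (scale b x) = scale (a * b) x.
Proof. by rewrite /scale scalerA rmorphM. Qed.
Let scale1 : left_id 1 scale.
Proof. by move=> x; rewrite /scale rmorph1 scale1r. Qed.
Let scaleDr : right_distributive scale +%R.
Proof. by move=> a x y; rewrite /scale scalerDr. Qed.
Let scaleDl x : {morph scale^~ x : a b / a + b}.
Proof. by move=> a b; rewrite /scale rmorphD scalerDl. Qed.

HB.instance Definition _ := GRing.Zmodule_isLmodule.Build R N
  scaleA scale1 scaleDr scaleDl.

End RestrictScalars.

Section Algebraic.
Variables (l : nat) (L : closedFieldType) (iota : {rmorphism Zl l -> L}).
Hypotheses (l_prime : prime l) (iota_inj : injective iota).

Lemma iota_eq0 c : iota c = 0 -> c = 0.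
Proof. by rewrite -(rmorph0 iota) => /iota_inj. Qed.

Lemma iota_l_neq0 m : (l ^ m)%N%:R != 0 :> L.
Proof.
apply/eqP; rewrite -(rmorph_nat iota) => /iota_eq0.
rewrite natrX -[_ ^+ m]mulr1 => /(Zl_mullX_inj l_prime).
exact: Zl_one_neq0.
Qed.

Lemma iota_coprime_neq0 n : coprime l n -> n%:R != 0 :> L.
Proof.
move=> /(Zl_unit_coprime l_prime)[u un]; apply/eqP => n0.
have := congr1 iota un; rewrite rmorphM rmorph_nat n0 mulr0 rmorph1 => /eqP.
by rewrite eq_sym oner_eq0.
Qed.

(** In a relation between the powers of alpha, the coefficient of least degree is
    a multiple of alpha. *)
Lemma multiple_in_Zl (B : finType) (g : B -> L) (alpha : L) :
    (forall t, exists c : B -> Zl l, alpha ^+ t = \sum_b iota (c b) * g b) ->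
    alpha != 0 ->
  exists2 c : Zl l, c <> 0 & exists r (q : 'I_r -> Zl l),
    iota c = alpha * \sum_i iota (q i) * alpha ^+ i.
Proof.
move=> /choice[A AE] alpha0.
have [c [[t0 ct0] cA]] := linear_dependence (@Zl_one_neq0 l) (@Zl_integral l l_prime)
  (fun (t : 'I_#|B|.+1) (i : 'I_#|B|) => A t (enum_val i)) (ltnSn _).
pose e t := c (inord t).
have rel : \sum_(t < #|B|.+1) iota (e t) * alpha ^+ t = 0.
  under eq_bigr do rewrite /e inord_val AE mulr_sumr.
  rewrite exchange_big big1 // => b _ /=.
  have cAb : \sum_t c t * A t b = 0.
    by rewrite -[RHS](cA (enum_rank b)); apply: eq_bigr => t _; rewrite enum_rankK.
  transitivity (iota (\sum_t c t * A t b) * g b); last by rewrite cAb rmorph0 mul0r.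
  rewrite rmorph_sum mulr_suml; apply: eq_bigr => t _.
  by rewrite rmorphM mulrA.
have : exists t, (t < #|B|.+1)%N /\ e t <> 0.
  by exists t0; split=> //; rewrite /e inord_val.
elim: #|B|.+1 e rel => {t0 c ct0 cA} [|n IHn] c; first by move=> _ [t []].
rewrite big_ord_recl expr0 mulr1 => rel [t [tn ct]].
have [c0|/eqP c0] := eqVneq (c 0%N) 0; last first.
  exists (c 0%N) => //; exists n, (fun i => - c i.+1).
  transitivity (- \sum_(i < n) iota (c i.+1) * alpha ^+ i.+1).
    by apply/eqP; rewrite -addr_eq0; apply/eqP; exact: rel.
  rewrite mulr_sumr -sumrN; apply: eq_bigr => i _.
  by rewrite rmorphN mulNr mulrN exprS mulrCA.
apply: (IHn (fun i => c i.+1)).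
  rewrite c0 rmorph0 add0r in rel.
  apply: (mulfI alpha0); rewrite mulr0 -[RHS]rel mulr_sumr.
  by apply: eq_bigr => i _; rewrite exprS mulrCA.
by case: t tn ct => // t tn ct; exists t.
Qed.

End Algebraic.

Section CyclotomicDegree.
Variables (l p : nat) (L : closedFieldType) (iota : {rmorphism Zl l -> L}).
Hypotheses (l_prime : prime l) (p_prime : prime p) (l_neq_p : l != p).
Hypothesis iota_inj : injective iota.

Local Notation LZ := (restrict_scalars iota L^o).

Let p_neq0 : p%:R != 0 :> L.
Proof.
apply: (iota_coprime_neq0 iota l_prime).
by rewrite prime_coprime // dvdn_prime2.
Qed.

(** A root of X ^ (p ^ n) = y, where y is a root of 1 + X + ... + X ^ p.-1. *)
Lemma primitive_root_exists n : exists z : L, (p ^ n).-primitive_root z.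
Proof.
case: n => [|n].
  have [m m_prim] := @prim_order_exists L 1 1 isT (expr1n _ _).
  by rewrite dvdn1 => /eqP m1; exists 1; rewrite expn0 -m1.
have p_gt1 := prime_gt1 p_prime.
have [y] : exists y, root (\poly_(i < p) (1 : L)) y.
  apply/closed_rootP; rewrite size_poly_eq ?oner_eq0 //.
  by rewrite neq_ltn p_gt1 orbT.
rewrite rootE horner_poly; under eq_bigr do rewrite mul1r.
move=> /eqP y_sum.
have yp : y ^+ p = 1 by apply/eqP; rewrite -subr_eq0 subrX1 y_sum mulr0.
have y1 : y != 1.
  apply/eqP => y1; move: y_sum; rewrite y1; under eq_bigr do rewrite expr1n.
  by rewrite sumr_const card_ord => /eqP; apply/negP.
have pn0 : (0 < p ^ n)%N by rewrite expn_gt0 prime_gt0.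
have [z] : exists z, root ('X^(p ^ n) - y%:P) z.
  by apply/closed_rootP; rewrite size_XnsubC // eqSS -lt0n.
rewrite rootE !hornerE subr_eq0 => /eqP zy.
have zN : z ^+ (p ^ n.+1) = 1 by rewrite expnSr exprM zy.
have [|m prim_m] := @prim_order_exists L (p ^ n.+1) z _ zN.
  by rewrite expn_gt0 prime_gt0.
move=> /(dvdn_pfactor _ _ p_prime)[j].
rewrite leq_eqVlt => /predU1P[-> mE|]; first by exists z; rewrite -mE.
rewrite ltnS => jn mE; case/eqP: y1.
by rewrite -zy -(subnKC jn) expnD exprM -mE (prim_expr_order prim_m) expr1n.
Qed.

Lemma LZ_scaleE (c : Zl l) (x : LZ) : c *: x = iota c * x.
Proof. by []. Qed.

Variables (n : nat) (z : L).
Hypothesis z_prim : (p ^ n).-primitive_root z.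

(** The ring Z_l[mu_(p^n)]. *)
Definition cyclotomic_integers : set LZ := zspan (fun i : 'I_(p ^ n) => z ^+ i : LZ).
Local Notation O := cyclotomic_integers.

Let mO : submodule O. Proof. exact: zspan_submodule. Qed.
Let sO : subgroup O. Proof. exact: mO.1. Qed.

Lemma cyclotomic_integersX k : O (z ^+ k).
Proof.
have kN : (k %% p ^ n < p ^ n)%N by rewrite ltn_mod expn_gt0 prime_gt0.
rewrite -(prim_expr_mod z_prim); exact: (zspan_mem _ (Ordinal kN)).
Qed.

Lemma cyclotomic_integers1 : O 1.
Proof. exact: (cyclotomic_integersX 0). Qed.

Lemma cyclotomic_integersM x y : O x -> O y -> O (x * y : L).
Proof.
move=> [c ->] [d ->]; rewrite mulr_suml; apply: subgroup_sum => // i _.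
rewrite mulr_sumr; apply: subgroup_sum => // j _.
rewrite !LZ_scaleE mulrACA -rmorphM -exprD -LZ_scaleE.
by apply: mO.2; apply: cyclotomic_integersX.
Qed.

Lemma cyclotomic_integers_exp x k : O x -> O (x ^+ k : L).
Proof.
move=> Ox; elim: k => [|k IHk]; first exact: cyclotomic_integers1.
by rewrite exprS; apply: cyclotomic_integersM.
Qed.

Lemma cyclotomic_integers_iota c : O (iota c).
Proof. by rewrite -[iota c]mulr1 -LZ_scaleE; apply: mO.2; apply: cyclotomic_integers1. Qed.

Lemma l_torsion_LZ (x : LZ) : l_torsion l x -> x = 0.
Proof.
move=> [m]; rewrite -mulr_natr => /eqP.
by rewrite mulf_eq0 (negPf (iota_l_neq0 l_prime iota_inj m)) orbF => /eqP.
Qed.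

Lemma cyclotomic_integers_basis : exists k (g : 'I_k -> LZ), [/\ O = zspan g,
    forall c : 'I_k -> Zl l, \sum_i c i *: g i = 0 -> forall i, c i = 0 &
    quot_card O (l_multiples_tors l O) (l ^ k)].
Proof.
have [|k [g [Og gO g_free qO]]] := @basis_mod_torsion l l_prime LZ O.
  by exists 'I_(p ^ n), (fun i : 'I_(p ^ n) => z ^+ i).
exists k, g; split=> //; apply/seteqP; split=> [x Ox|_ [c ->]].
  by have [c /l_torsion_LZ/subr0_eq ->] := gO x Ox; exists c.
exact: submodule_sum.
Qed.

Definition cyc_cong m (x y : L) := exists2 w, O w & x - y = w *+ l ^ m.
Local Notation "x =[ m ]= y" := (cyc_cong m x y) (at level 70).

Lemma cyc_cong_refl m x : x =[m]= x.
Proof. by exists 0; rewrite ?mul0rn ?subrr //; apply: subgroup0. Qed.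

Lemma cyc_cong_sym m x y : x =[m]= y -> y =[m]= x.
Proof.
move=> [w Ow xy]; exists (- w); first exact: subgroupN.
by rewrite -opprB xy mulNrn.
Qed.

Lemma cyc_cong_trans m x y t : x =[m]= y -> y =[m]= t -> x =[m]= t.
Proof.
move=> [w Ow xy] [v Ov yt]; exists (w + v); first exact: subgroupD.
by rewrite mulrnDl -xy -yt subrKA.
Qed.

Lemma cyc_congD m x y x' y' : x =[m]= y -> x' =[m]= y' -> x + x' =[m]= y + y'.
Proof.
move=> [w Ow xy] [v Ov yt]; exists (w + v); first exact: subgroupD.
by rewrite mulrnDl -xy -yt opprD addrACA.
Qed.

Lemma cyc_congW m m' x y : (m' <= m)%N -> x =[m]= y -> x =[m']= y.
Proof.
move=> mm' [w Ow xy]; exists (w *+ l ^ (m - m')); first exact: subgroupMn.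
by rewrite -mulrnA -expnD subnK.
Qed.

Lemma cyc_congM m x y t : O t -> x =[m]= y -> x * t =[m]= y * t.
Proof.
move=> Ot [w Ow xy]; exists (w * t); first exact: cyclotomic_integersM.
by rewrite -mulrBl xy mulrnAl.
Qed.

Lemma cyc_cong_exp m k x y : O x -> O y -> x =[m]= y -> x ^+ k =[m]= y ^+ k.
Proof.
move=> Ox Oy xy; elim: k => [|k IHk]; first exact: cyc_cong_refl.
rewrite !exprS; apply: (cyc_cong_trans (cyc_congM (cyclotomic_integers_exp k Ox) xy)).
by rewrite mulrC [y * _]mulrC; apply: cyc_congM.
Qed.

(** In x ^ l - y ^ l = (x - y) (x ^ l.-1 + ... + y ^ l.-1) the second factor is
    congruent to l y ^ l.-1 modulo l, so that it is a multiple of l. *)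
Lemma cyc_cong_exp_l m x y : O x -> O y -> x =[m.+1]= y -> x ^+ l =[m.+2]= y ^+ l.
Proof.
move=> Ox Oy xy; have [w Ow wE] := xy.
have /choice[v vE] (i : 'I_l) : exists v, O v /\
    x ^+ (l.-1 - i) * y ^+ i = y ^+ l.-1 + v *+ l.
  have := cyc_cong_exp (l.-1 - i) Ox Oy (cyc_congW (isT : (1 <= m.+1)%N) xy).
  move=> /(cyc_congM (cyclotomic_integers_exp i Oy))[v Ov vE].
  exists v; split=> //; rewrite -[v *+ l]/(v *+ l ^ 1) -vE -exprD subnK ?subrKC //.
  by rewrite -ltnS prednK ?prime_gt0.
exists (w * (y ^+ l.-1 + \sum_i v i)).
  apply: cyclotomic_integersM => //; apply: subgroupD => //.
    exact: cyclotomic_integers_exp.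
  by apply: subgroup_sum => // i _; case: (vE i).
rewrite subrXX wE; under eq_bigr do rewrite (vE _).2.
rewrite big_split /= sumr_const card_ord sumrMnl -mulrnDl.
by rewrite mulrnAl mulrnAr -mulrnA -expnS.
Qed.

Lemma cyc_frobeniusD x y : O x -> O y -> (x + y) ^+ l =[1]= x ^+ l + y ^+ l.
Proof.
move=> Ox Oy; have l0 := prime_gt0 l_prime.
have expand k : (x + y) ^+ k.+1 = x ^+ k.+1
    + \sum_(i < k) x ^+ (k.+1 - i.+1) * y ^+ i.+1 *+ 'C(k.+1, i.+1) + y ^+ k.+1.
  rewrite exprDn big_ord_recl big_ord_recr /= subn0 expr0 mulr1 bin0 mulr1n.
  by rewrite addrA subnn expr0 mul1r binn mulr1n.
exists (\sum_(i < l.-1) x ^+ (l - i.+1) * y ^+ i.+1 *+ ('C(l, i.+1) %/ l)).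
  apply: subgroup_sum => // i _; apply: subgroupMn => //.
  by apply: cyclotomic_integersM; apply: cyclotomic_integers_exp.
have := expand l.-1; rewrite prednK // => ->.
rewrite addrAC opprD addrA addrAC -addrA subrr addr0 addrAC subrr add0r.
rewrite -sumrMnl; apply: eq_bigr => i _; rewrite -mulrnA divnK //.
by rewrite prime_dvd_bin //= -ltn_predRL.
Qed.

Lemma Zl_fermat (c : Zl l) : exists r, c ^+ l = c + l%:R * r.
Proof.
have [m [r cE]] : exists m : nat, exists r, c = m%:R + l%:R * r.
  by have [a h] := Zl_residue l_prime c; exists a.
have [s sE] : exists s, c ^+ l - m%:R ^+ l = l%:R * s.
  by rewrite subrXX {1}cE addrAC subrr add0r -mulrA; eexists.
have lm : (m <= m ^ l)%N.
  by case: m {cE sE} => // m; rewrite -{1}[m.+1]expn1 leq_pexp2l // prime_gt0.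
have /dvdnP[t tE] : (l %| m ^ l - m)%N.
  by rewrite -eqn_mod_dvd //; apply/eqP/fermat_little.
have lt : l%:R * t%:R = m%:R ^+ l - m%:R :> Zl l.
  by rewrite -natrM mulnC -tE natrB // natrX.
exists (s + t%:R - r).
by rewrite mulrBr mulrDr -sE lt subrKA -addrA -opprD -cE subrKC.
Qed.

Lemma cyc_frobenius_sum (B : Type) (s : seq B) (c : B -> Zl l) (y : B -> L) :
    (forall b, O (y b)) ->
  (\sum_(b <- s) iota (c b) * y b) ^+ l =[1]= \sum_(b <- s) iota (c b) * y b ^+ l.
Proof.
move=> Oy; have OS (s' : seq B) : O (\sum_(b <- s') iota (c b) * y b).
  by apply: subgroup_sum => // b _; apply: mO.2.
elim: s => [|b s IHs].
  by rewrite !big_nil expr0n gtn_eqF ?prime_gt0 //; apply: cyc_cong_refl.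
rewrite !big_cons; apply: (cyc_cong_trans (cyc_frobeniusD (mO.2 _ _ (Oy b)) (OS s))).
apply: cyc_congD IHs; rewrite exprMn; apply: cyc_congM.
  exact: cyclotomic_integers_exp.
have [r rE] := Zl_fermat (c b).
exists (iota r); first exact: cyclotomic_integers_iota.
rewrite -rmorphXn rE rmorphD rmorphM rmorph_nat addrAC subrr add0r.
by rewrite mulr_natl.
Qed.

(** The l ^ d-th power map is the identity modulo l, since it fixes the roots
    of unity. *)
Lemma cyc_frobenius_iter d x : (l ^ d = 1 %[mod p ^ n])%N -> O x ->
  x ^+ (l ^ d) =[1]= x.
Proof.
move=> ld [c ->].
have Oz (j : nat) (i : 'I_(p ^ n)) : O (z ^+ (i * j)) by apply: cyclotomic_integersX.
have step j : (\sum_i iota (c i) * z ^+ i) ^+ (l ^ j) =[1]=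
    \sum_i iota (c i) * z ^+ (i * l ^ j).
  elim: j => [|j IHj].
    rewrite expn0 expr1; under [in X in _ =[1]= X]eq_bigr do rewrite muln1.
    exact: cyc_cong_refl.
  rewrite expnSr exprM; apply: cyc_cong_trans.
    apply: cyc_cong_exp IHj; last by apply: subgroup_sum => // i _; apply: mO.2.
    apply: cyclotomic_integers_exp; apply: subgroup_sum => // i _; apply: mO.2.
    exact: cyclotomic_integersX.
  have := cyc_frobenius_sum (index_enum _) c (Oz (l ^ j)%N).
  by under [in X in _ =[1]= X -> _]eq_bigr do rewrite -exprM -mulnA.
have := step d; congr (_ =[1]= _); apply: eq_bigr => i _.
rewrite mulnC exprM -(prim_expr_mod z_prim) ld (prim_expr_mod z_prim) expr1.
by [].
Qed.

Lemma cyc_separated x y : O x -> O y -> (forall m, x =[m]= y) -> x = y.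
Proof.
move=> Ox Oy xy; have [k [g [OE g_free _]]] := cyclotomic_integers_basis.
have : O (x - y) by apply: subgroupB.
rewrite OE => -[c cE]; apply: subr0_eq; rewrite cE big1 // => i _.
suff -> : c i = 0 by rewrite scale0r.
apply: ringlim_eq => m; have [w Ow wE] := xy m.+1.
move: Ow; rewrite OE => -[d dE].
have cd : forall i, c i - l%:R ^+ m.+1 * d i = 0.
  apply: g_free; under eq_bigr do rewrite scalerBl -scalerA.
  by rewrite sumrB -cE -scaler_sumr -dE wE scale_lX subrr.
rewrite (subr0_eq (cd i)); apply: val_inj.
by rewrite -natrX [LHS]Zl_mul_val // Zl_natE_val // modnn mul0n mod0n.
Qed.

(** Each coordinate of y m.+1 - y m on the powers of z is l ^ m times an element of
    Z_l, and the resulting series converge in Z_l. *)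
Lemma cyc_complete (y : nat -> L) : (forall m, O (y m)) ->
  (forall m, y m.+1 =[m]= y m) -> exists t, O t /\ forall m, t =[m]= y m.
Proof.
move=> Oy yy.
have /choice[b bE] m : exists b : 'I_(p ^ n) -> Zl l,
    y m.+1 - y m = l%:R ^+ m *: (\sum_i b i *: (z ^+ i : LZ) : LZ).
  by have [_ [b ->] ->] := yy m; exists b; rewrite scale_lX.
have /choice[c cE] i := Zl_series l_prime (fun m => b m i).
exists (y 0%N + (\sum_i c i *: (z ^+ i : LZ) : LZ)); split.
  by apply: subgroupD => //; exists c.
move=> m; have /choice[r rE] i := cE i m.
exists (\sum_i r i *: (z ^+ i : LZ)); first by exists r.
have yE : y m = y 0%N + \sum_(k < m) (y k.+1 - y k).
  by rewrite -(big_mkord xpredT (fun k => y k.+1 - y k)) telescope_sumr // subrKC.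
rewrite yE opprD addrACA subrr add0r -[RHS]/((_ : LZ) *+ _) -scale_lX.
under [X in _ - X]eq_bigr do rewrite bE scaler_sumr.
rewrite exchange_big -sumrB scaler_sumr; apply: eq_bigr => i _ /=.
under eq_bigr do rewrite scalerA.
transitivity ((c i - \sum_(k < m) l%:R ^+ k * b k i) *: (z ^+ i : LZ)).
  by rewrite scalerBl scaler_suml.
by rewrite {1}(rE i) addrAC subrr add0r scalerA.
Qed.

(** The Teichmuller representative of x: the sequence of the x ^ (l ^ (d k)) is
    Cauchy, and its limit is fixed by the l ^ d-th power map, which shifts it. *)
Lemma teichmuller d x : (0 < d)%N -> (l ^ d = 1 %[mod p ^ n])%N -> O x ->
  exists t, t ^+ (l ^ d) = t /\ t =[1]= x.
Proof.
move=> d0 ld Ox; pose y k := x ^+ ((l ^ d) ^ k).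
have Oy k : O (y k) by apply: cyclotomic_integers_exp.
have yS k : y k.+1 = y k ^+ (l ^ d) by rewrite /y expnSr exprM.
have yy k : y k.+1 =[k.+1]= y k.
  elim: k => [|k IHk]; first by rewrite /y expn1 expr1; apply: cyc_frobenius_iter.
  rewrite yS {2}yS -(prednK d0) expnS !exprM.
  apply: cyc_cong_exp; try exact: cyclotomic_integers_exp.
  exact: cyc_cong_exp_l.
have [t [Ot tE]] := cyc_complete Oy (fun k => cyc_congW (leqnSn k) (yy k)).
exists t; split; last first.
  apply: cyc_cong_trans (tE 1%N) _; rewrite -[X in _ =[1]= X]expr1.
  exact: (yy 0%N).
apply: cyc_separated => // [|m]; first exact: cyclotomic_integers_exp.
apply: (cyc_cong_trans (cyc_cong_exp _ Ot (Oy m) (tE m))).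
rewrite -yS; apply: (cyc_cong_trans (cyc_congW (leqnSn m) (yy m))).
exact: cyc_cong_sym.
Qed.

Definition mul_LZ (a : L) (x : LZ) : LZ := a * x.
Lemma mul_LZ_is_linear a : linear (mul_LZ a).
Proof. by move=> c x y; rewrite /mul_LZ !LZ_scaleE mulrDr mulrCA. Qed.
HB.instance Definition _ a :=
  GRing.isLinear.Build (Zl l) LZ LZ _ (mul_LZ a) (mul_LZ_is_linear a).

(** The rank k of O is the order d of l modulo p ^ n: d divides k because
    multiplication by a primitive root acts freely on O / l O, and k <= d
    because the Teichmuller representatives embed O / l O into the set of roots
    of X ^ (l ^ d) - X. *)
Lemma cyclotomic_integers_rank k d : order_mod l (p ^ n) d ->
  quot_card O (l_multiples_tors l O) (l ^ k) -> k = d.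
Proof.
move=> [d0 dE] qO; have Kn := @l_multiples_tors_natural l.
have sK : subgroup (l_multiples_tors l O) by case: (Kn.1 _ _ mO).
apply/eqP; rewrite eqn_leq; apply/andP; split.
- have ld : (l ^ d = 1 %[mod p ^ n])%N by apply/eqP; rewrite dE.
  have [f [Of fi _]] := qO.
  have /choice[t tE] i : exists t : L, t ^+ (l ^ d) = t /\ cyc_cong 1 t (f i).
    exact: teichmuller.
  rewrite -(leq_exp2l _ _ (prime_gt1 l_prime)).
  have t_inj : injective t.
    move=> i j tij; apply: fi.
    have [w Ow wE] : cyc_cong 1 (f i) (f j).
      by apply: cyc_cong_trans (cyc_cong_sym (tE i).2) _; rewrite tij; apply: (tE j).2.
    by exists 0%N, w => //; rewrite mulr1n.
  have q1 : (1 < l ^ d)%N by rewrite -(expn0 l) ltn_exp2l // prime_gt1.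
  have sz : size ('X^(l ^ d) - 'X : {poly L}) = (l ^ d).+1.
    by rewrite size_polyDl ?size_polyXn // size_polyN size_polyX.
  have := @max_poly_roots L ('X^(l ^ d) - 'X) [seq t i | i <- enum 'I_(l ^ k)].
  rewrite sz size_map size_enum_ord ltnS; apply.
  + by rewrite -size_poly_gt0 sz.
  + apply/allP => _ /mapP[i _ ->]; rewrite rootE !hornerE (tE i).1 subrr //.
  + by rewrite map_inj_uniq ?enum_uniq.
- have k0 : (0 < k)%N.
    rewrite lt0n; apply/eqP => k0.
    have [j [g [OE _ qO']]] := cyclotomic_integers_basis.
    have jk : (l ^ j = l ^ k)%N by apply: quot_card_unique sK qO' qO.
    have {jk} j0 : j = 0%N.
      by apply/eqP; move/eqP: jk; rewrite k0 eqn_exp2l ?prime_gt1.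
    subst j; have := cyclotomic_integers1; rewrite OE => -[c].
    by rewrite big_ord0 => /eqP; rewrite oner_eq0.
  apply: dvdn_leq => //; rewrite -dE; apply/eqP.
  case nE: n => [|m]; first by rewrite expn0 !modn1.
  have iterE j (x : LZ) : iter j (mul_LZ z) x = z ^+ j * x.
    elim: j => [|j IHj]; first by rewrite mul1r.
    by rewrite iterS IHj exprS -mulrA.
  apply: (@quot_card_free l l_prime _ LZ O (mul_LZ z) p m _ Kn) => //.
  + by move=> x Ox; apply: cyclotomic_integersM => //; apply: (cyclotomic_integersX 1).
  + by move=> x _; rewrite iterE -nE (prim_expr_order z_prim) mul1r.
  + move=> x _; under eq_bigr do rewrite iterE.
    rewrite -mulr_suml; suff -> : \sum_(i < p) z ^+ (i * p ^ m) = 0 by rewrite mul0r.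
    have u1 : z ^+ (p ^ m) != 1.
      rewrite -(prim_order_dvd z_prim) nE gtnNdvd ?expn_gt0 ?prime_gt0 //.
      by rewrite ltn_exp2l ?prime_gt1.
    apply: (mulfI (x := z ^+ (p ^ m) - 1)); first by rewrite subr_eq0.
    under eq_bigr do rewrite mulnC exprM.
    by rewrite -subrX1 mulr0 -exprM -expnSr -nE (prim_expr_order z_prim) subrr.
Qed.

Lemma common_denominator (S : set L) k (x : 'I_k -> L) :
    (forall a y, S y -> S (iota a * y)) ->
    (forall i, exists2 b, b <> 0 & S (iota b * x i)) ->
  exists2 b, b <> 0 & forall i, S (iota b * x i).
Proof.
move=> SZ; elim: k x => [|k IHk] x Sx.
  by exists 1 => [|[]//]; apply: Zl_one_neq0.
have [b b0 Sb] := Sx ord0.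
have [c c0 Sc] := IHk (fun i => x (lift ord0 i)) (fun i => Sx _).
exists (b * c); first by move=> /(Zl_integral l_prime)[].
move=> i; rewrite rmorphM; have [j ->|->] := unliftP ord0 i.
  by rewrite -mulrA; apply: SZ.
by rewrite mulrAC mulrC; apply: SZ.
Qed.

Lemma iota_neq0 c : c <> 0 -> iota c != 0.
Proof. by move=> c0; apply/eqP => /(iota_eq0 iota_inj). Qed.

(** The fraction field of O, in the form of fractions with denominators in Z_l: the
    inverse of an element of O has such a form by multiple_in_Zl. *)
Let frac_O : {pred L} := [pred x | `[< exists2 b, b <> 0 & O (iota b * x) >]].

Let frac_OP x : reflect (exists2 b, b <> 0 & O (iota b * x)) (x \in frac_O).
Proof. exact: asboolP. Qed.

Let frac_O_divring : divring_closed frac_O.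
Proof.
split=> [|x y|x y].
- apply/frac_OP; exists 1; first exact: Zl_one_neq0.
  by rewrite rmorph1 mulr1; apply: cyclotomic_integers1.
- move=> /frac_OP[b b0 Ob] /frac_OP[c c0 Oc]; apply/frac_OP; exists (b * c).
    by move=> /(Zl_integral l_prime)[].
  rewrite mulrBr rmorphM; apply: subgroupB => //; last by rewrite -mulrA; apply: mO.2.
  by rewrite mulrAC mulrC; apply: mO.2.
- move=> /frac_OP[b b0 Ob] /frac_OP[c c0 Oc]; apply/frac_OP.
  have [->|y0] := eqVneq y 0.
    exists 1; first exact: Zl_one_neq0.
    by rewrite invr0 !mulr0; apply: subgroup0.
  pose alpha := iota c * y.
  have alpha0 : alpha != 0 by rewrite mulf_neq0 // iota_neq0.
  have pows t : exists c : 'I_(p ^ n) -> Zl l, alpha ^+ t = \sum_i iota (c i) * z ^+ i.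
    exact: (cyclotomic_integers_exp t Oc).
  have [e e0 [r [q eE]]] := multiple_in_Zl l_prime pows alpha0.
  (* e / alpha = sum_i q_i alpha ^ i is in O, and 1 / y = c / alpha *)
  pose beta := \sum_i iota (q i) * alpha ^+ i.
  have Obeta : O beta.
    apply: subgroup_sum => // i _; apply: mO.2; exact: (cyclotomic_integers_exp i Oc).
  exists (b * e); first by move=> /(Zl_integral l_prime)[].
  have -> : iota (b * e) * (x / y) = (iota b * x) * (iota c * beta).
    rewrite rmorphM eE -/beta /alpha -!mulrA; congr (_ * _).
    by rewrite [y * _]mulrC -!mulrA mulVf // mulr1 [RHS]mulrC mulrA.
  by apply: cyclotomic_integersM => //; apply: mO.2.
Qed.

(** A basis of O over Z_l is one of Q_l(mu_(p^n)) over Q_l. *)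
Lemma cyclotomic_degree_of_order d : order_mod l (p ^ n) d ->
  cyclotomic_degree iota p n = d.
Proof.
move=> dE; have [k [g [OE g_free qO]]] := cyclotomic_integers_basis.
rewrite -(cyclotomic_integers_rank dE qO) => {d dE}.
have g_freeL (c : 'I_k -> Zl l) : \sum_i iota (c i) * g i = 0 -> forall i, c i = 0.
  exact: g_free.
apply: max_nat_eq.
- exists g; split=> [i K [K1 KB KV] KQ Kmu|c cQ cg].
  + have [d ->] : O (g i) by rewrite OE; apply: zspan_mem.
    have K0 : 0 \in K by rewrite -(subrr 1) KB.
    have KD x y : x \in K -> y \in K -> x + y \in K.
      by move=> Kx Ky; rewrite -[y]opprK KB // -sub0r KB.
    have KM x y : x \in K -> y \in K -> x * y \in K.
      by move=> Kx Ky; rewrite -[y]invrK KV // -div1r KV.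
    apply: (big_ind (fun x => x \in K)) => // j _; apply: KM.
      apply: KQ; exists (d j), 1; rewrite rmorph1 divr1; split=> //.
      exact: oner_neq0.
    by apply: Kmu; rewrite /mu /= -exprM mulnC exprM (prim_expr_order z_prim) expr1n.
  + have [|i|b b0 bE] := @common_denominator (range iota) k c.
    * by move=> a _ [e _ <-]; exists (a * e); rewrite // rmorphM.
    * have [a [b [b0 cE]]] := cQ i; exists b.
        by move=> b_eq0; case/eqP: b0; rewrite b_eq0 rmorph0.
      by exists a => //; rewrite cE mulrCA divff // mulr1.
    have /choice[e eE] i : exists e, iota e = iota b * c i.
      by have [e _ ?] := bE i; exists e.
    have e0 : forall i, e i = 0.
      apply: g_freeL; under eq_bigr do rewrite eE -mulrA.
      by rewrite -mulr_sumr cg mulr0.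
    move=> i; apply: (mulfI (iota_neq0 b0)).
    by rewrite mulr0 -eE e0 rmorph0.
- move=> j [x [xC x_free]]; rewrite leqNgt; apply/negP => kj.
  have xF i : exists2 b, b <> 0 & O (iota b * x i).
    apply/frac_OP; apply: (xC i) => //.
    + move=> y [a [b [b0 ->]]]; apply/frac_OP; exists b.
        by move=> b_eq0; case/eqP: b0; rewrite b_eq0 rmorph0.
      by rewrite mulrCA divff // mulr1; apply: cyclotomic_integers_iota.
    + move=> y yN; apply/frac_OP; exists 1; first exact: Zl_one_neq0.
      rewrite rmorph1 mul1r.
      have /(prim_rootP z_prim)[j0 ->] : y ^+ (p ^ n) = 1 by [].
      exact: cyclotomic_integersX.
  have [b b0 xO] := common_denominator mO.2 xF.
  have /choice[A AE] i : exists a : 'I_k -> Zl l, iota b * x i = \sum_i' iota (a i') * g i'.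
    by have := xO i; rewrite OE.
  have [c [[i0 ci0] cA]] :=
    linear_dependence (@Zl_one_neq0 l) (@Zl_integral l l_prime) A kj.
  apply: ci0; apply: (iota_eq0 iota_inj).
  apply: (x_free (fun i => iota (c i))).
    move=> i; exists (c i), 1; rewrite rmorph1 divr1; split=> //.
    exact: oner_neq0.
  apply: (mulfI (iota_neq0 b0)); rewrite mulr0 mulr_sumr.
  under eq_bigr do rewrite mulrCA AE mulr_sumr.
  rewrite exchange_big big1 // => i' _ /=.
  transitivity (iota (\sum_i c i * A i i') * g i').
    rewrite rmorph_sum mulr_suml; apply: eq_bigr => i _.
    by rewrite rmorphM mulrA.
  by rewrite cA rmorph0 mul0r.
Qed.

End CyclotomicDegree.

Lemma order_mod_cyclotomic_degree (l p : nat) (L : closedFieldType)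
    (iota : {rmorphism Zl l -> L}) n : prime l -> prime p -> l != p ->
  injective iota -> order_mod l (p ^ n) (cyclotomic_degree iota p n).
Proof.
move=> l_pr p_pr lp iota_inj.
have [z z_prim] := primitive_root_exists iota l_pr p_pr lp n.
have [|d dE] := @order_mod_exists l (p ^ n).
  case: n {z z_prim} => [|n]; rewrite ?coprimen1 // coprimeXr //.
  by rewrite prime_coprime // dvdn_prime2.
by rewrite (cyclotomic_degree_of_order l_pr p_pr lp iota_inj z_prim dE).
Qed.

(** * The Iwasawa algebra *)

(** For k = 0, preimages are chosen step by step. Otherwise, the system is shifted
    by one, and the element of index 0 is the image of the next one. *)
Lemma grplim_surj k (Gam : nat -> finGroupType)
    (tr : forall n, {morphism [set: Gam n.+1]%SET >-> Gam n}) :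
    (forall n (y : Gam n), exists x, tr n x = y) ->
  forall x : Gam k, exists g : grplim tr, g k = x.
Proof.
elim: k Gam tr => [|k IHk] Gam tr tr_surj x.
  have sE n (y : Gam n) := cid (tr_surj n y).
  pose g := nat_rect (fun n => Gam n : Type) x (fun n y => sval (sE n y)).
  have coh n : tr n (g n.+1) = g n by exact: svalP (sE n (g n)).
  by exists (GrpLim coh).
have [g gk] := IHk (fun n => Gam n.+1) (fun n => tr n.+1) (fun n => tr_surj n.+1) x.
pose h n : Gam n := if n is n'.+1 then g n' else tr 0%N (g 0%N).
have coh n : tr n (h n.+1) = h n by case: n => //= n; apply: grplim_coh.
by exists (GrpLim coh).
Qed.

Lemma ringlim_sum (R : nat -> pzRingType) (phi : forall n, {rmorphism R n.+1 -> R n})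
    (I : Type) (s : seq I) (P : pred I) (F : I -> ringlim phi) k :
  (\sum_(i <- s | P i) F i) k = \sum_(i <- s | P i) F i k.
Proof. by apply: (big_morph (fun x : ringlim phi => x k)). Qed.

Section IwasawaAlgebra.
Variables (l : nat) (Gam : nat -> finGroupType)
  (tr : forall n, {morphism [set: Gam n.+1]%SET >-> Gam n}).
Hypothesis Gam_abelian : forall n, abelian [set: Gam n]%SET.
Hypothesis tr_surj : forall n (y : Gam n), exists x, tr n x = y.

Local Notation Lambda := (Iwasawa l tr).
Local Notation Gamma := (grplim tr).

Lemma Gam_mulC k (x y : Gam k) : (x * y = y * x)%g.
Proof. by apply: (centsP (Gam_abelian k)); rewrite inE. Qed.

Lemma Iwasawa_mulC (x y : Lambda) : x * y = y * x.
Proof.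
apply: ringlim_eq => k; apply/ffunP => g; rewrite !ffunE.
rewrite (reindex_inj (inj_comp (mulgI g) invg_inj)) /=.
apply: eq_bigr => h _.
by rewrite invMg invgK -mulgA mulVg mulg1 mulrC Gam_mulC.
Qed.

Lemma grp_eltM k (a b : Zl l) (g h : Gam k) :
  grp_elt a g * grp_elt b h = grp_elt (a * b) (g * h)%g.
Proof.
apply/ffunP => x; rewrite !ffunE (bigD1 g) //= !ffunE eqxx big1 ?addr0 => [|y /negPf yg].
  by rewrite (can2_eq (mulKVg g) (mulKg g)); case: eqP => //; rewrite mulr0.
by rewrite !ffunE yg mul0r.
Qed.

Lemma iwasawa_eltM (a b : Zl l) (g h : Gamma) :
  iwasawa_elt a g * iwasawa_elt b h = iwasawa_elt (a * b) (g * h)%g :> Lambda.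
Proof. by apply: ringlim_eq => k; apply: grp_eltM. Qed.

Definition Zl_Iwasawa (a : Zl l) : Lambda := iwasawa_elt a 1%g.

Lemma Zl_Iwasawa_is_zmod_morphism : zmod_morphism Zl_Iwasawa.
Proof.
move=> a b; apply: ringlim_eq => k; apply/ffunP => g; rewrite !ffunE.
by case: eqP => // _; rewrite subr0.
Qed.

Lemma Zl_Iwasawa_is_monoid_morphism : monoid_morphism Zl_Iwasawa.
Proof.
split=> [|a b]; first exact: ringlim_eq.
by rewrite /Zl_Iwasawa iwasawa_eltM mulg1.
Qed.

HB.instance Definition _ := GRing.isZmodMorphism.Build (Zl l) Lambda Zl_Iwasawa
  Zl_Iwasawa_is_zmod_morphism.
HB.instance Definition _ := GRing.isMonoidMorphism.Build (Zl l) Lambda Zl_Iwasawa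
  Zl_Iwasawa_is_monoid_morphism.

Definition grp_lift k (x : Gam k) : Gamma := xget 1%g [set g : Gamma | g k = x].

Lemma grp_liftE k (x : Gam k) : grp_lift x k = x.
Proof.
have [g gx] := grplim_surj tr_surj x.
exact: (@xgetPex _ 1%g [set g : Gamma | g k = x]) (ex_intro _ g gx).
Qed.

Lemma grplim_eq_le k k' (g h : Gamma) : (k <= k')%N -> g k' = h k' -> g k = h k.
Proof.
elim: k' => [|k' IHk']; first by rewrite leqn0 => /eqP->.
rewrite leq_eqVlt => /predU1P[->//|]; rewrite ltnS => kk' gh.
by apply: IHk' => //; rewrite -(grplim_coh g k') -(grplim_coh h k') gh.
Qed.

Lemma level_push k k' (x : Lambda) (u : Gam k) : (k <= k')%N ->
  x k u = \sum_(g : Gam k' | grp_lift g k == u) x k' g.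
Proof.
elim: k' => [|k' IHk'].
  rewrite leqn0 => /eqP k0; subst k.
  by rewrite (big_pred1 u) // => g; rewrite grp_liftE.
rewrite leq_eqVlt => /predU1P[k0|]; first subst k.
  by rewrite (big_pred1 u) // => g; rewrite grp_liftE.
rewrite ltnS => kk'; rewrite IHk' //.
have lift_tr h : grp_lift (tr k' h) k = grp_lift h k.
  by apply: (grplim_eq_le kk'); rewrite grp_liftE -(grplim_coh _ k') grp_liftE.
rewrite (partition_big (tr k') (fun g => grp_lift g k == u)) /= => [|h]; last first.
  by rewrite lift_tr.
apply: eq_bigr => g gu; rewrite -[in LHS](ringlim_coh x k') ffunE.
apply: eq_bigl => h; case: eqP => [hg|_]; last by rewrite andbF.
by rewrite -lift_tr hg gu.
Qed.

(** A finite combination of elements of Gamma that approximates x: it has the same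
    component in Z_l[Gam k]. *)
Definition level_approx k (x : Lambda) : Lambda :=
  \sum_(g : Gam k) iwasawa_elt (x k g) (grp_lift g).

Lemma level_approxE k x : level_approx k x k = x k.
Proof.
rewrite /level_approx ringlim_sum; apply/ffunP => g; rewrite sum_ffunE.
rewrite (bigD1 g) //= ffunE grp_liftE eqxx big1 ?addr0 // => h /negPf hg.
by rewrite ffunE grp_liftE eq_sym hg.
Qed.

(** At a level k' >= k, write x as a combination of elements g of Gam k', and let
    h g be a lift of the image of g in Gam k. Then x is the sum of the
    x_g h (h^-1 g - 1), where h^-1 g is in the kernel of the projection to Gam k,
    and of the x_g h, which vanishes as it depends only on the image of x in
    Z_l[Gam k]. *)
Lemma kernel_sub_I_ideal k (x : Lambda) : x k = 0 -> I_ideal l tr k x.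
Proof.
move=> xk k' j.
have [kk'|k'k] := leqP k k'; last first.
  exists 0; first by exists 0%N, (fun=> 0), (fun=> 0); split=> [[]//|]; rewrite big_ord0.
  suff -> : x k' = 0 by [].
  elim: k k'k xk => // k IHk k'k xk.
  have xk' : x k = 0 by rewrite -(ringlim_coh x) xk rmorph0.
  by move: k'k; rewrite ltnS leq_eqVlt => /predU1P[->|/IHk]; auto.
pose h (g : Gam k') := grp_lift (grp_lift g k).
pose y : Lambda := \sum_(g : Gam k') iwasawa_elt (x k' g) (h g) *
  (iwasawa_elt 1 ((h g)^-1 * grp_lift g)%g - 1).
exists y.
  exists #|Gam k'|, (fun i => iwasawa_elt (x k' (enum_val i)) (h (enum_val i))),
    (fun i => iwasawa_elt 1 ((h (enum_val i))^-1 * grp_lift (enum_val i))%g - 1); split.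
    move=> i; exists ((h (enum_val i))^-1 * grp_lift (enum_val i))%g => //.
    by rewrite /ker_proj /= /grplim_mul /= /h grp_liftE mulVg.
  by rewrite /y (reindex (@enum_val _ predT)) //; apply: onW_bij; apply: enum_val_bij.
suff -> : y k' = x k' by [].
have -> : y = level_approx k' x - \sum_(g : Gam k') iwasawa_elt (x k' g) (h g).
  rewrite /y /level_approx -sumrB; apply: eq_bigr => g _.
  by rewrite mulrBr mulr1 iwasawa_eltM mulr1 mulKVg.
rewrite -[LHS]/(level_approx k' x k' - (\sum_g iwasawa_elt (x k' g) (h g) : Lambda) k').
rewrite level_approxE; apply/eqP; rewrite subr_eq addrC -subr_eq subrr eq_sym; apply/eqP.
have -> : (\sum_g iwasawa_elt (x k' g) (h g) : Lambda) = level_approx k x.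
  rewrite /level_approx (partition_big (fun g => grp_lift g k) xpredT) //=.
  apply: eq_bigr => u _; rewrite (level_push x u kk').
  apply: ringlim_eq => m; rewrite ringlim_sum; apply/ffunP => v.
  rewrite sum_ffunE /= /grp_elt ffunE.
  under eq_bigr => g /eqP gu do rewrite ffunE /h gu.
  by case: eqP => // _; rewrite big1.
suff -> : level_approx k x = 0 by [].
rewrite /level_approx big1 // => u _; rewrite xk ffunE.
by apply: ringlim_eq => m; apply/ffunP => v; rewrite !ffunE if_same.
Qed.

End IwasawaAlgebra.

(** * Characters and idempotents *)

Section Characters.
Variables (l p : nat) (Gam : nat -> finGroupType)
  (tr : forall n, {morphism [set: Gam n.+1]%SET >-> Gam n}).
Variables (L : closedFieldType) (iota : {rmorphism Zl l -> L}).
Hypotheses (l_prime : prime l) (p_prime : prime p) (l_neq_p : l != p).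
Hypothesis Gam_pgroup : forall n, (p.-group [set: Gam n]%SET)%g.
Hypothesis tr_surj : forall n (y : Gam n), exists x, tr n x = y.

Local Notation Lambda := (Iwasawa l tr).
Local Notation Gamma := (grplim tr).
Local Notation lift := (grp_lift tr).
Implicit Types (w v u : Gamma -> L) (x : Lambda) (g h : Gamma).

Definition char_of_level k w :=
  [/\ forall g h, w (g * h)%g = w g * w h, w 1%g = 1 &
      forall g h, g k = h k -> w g = w h].

Lemma char_of_level_exists w : continuous_character w -> exists k, char_of_level k w.
Proof.
move=> [wM w_root w_loc].
have w_neq0 g : w g != 0.
  have [m m0 wm] := w_root g; apply/eqP => wg0; move: wm.
  by rewrite /mu /= wg0 expr0n gtn_eqF // => /eqP; rewrite eq_sym oner_eq0.
have w1 : w 1%g = 1 by apply: (mulfI (w_neq0 1%g)); rewrite -wM mulg1 mulr1.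
have [k wk] := w_loc 1%g; exists k; split=> // g h gh.
rewrite -[g](mulKVg h) wM (wk (h^-1 * g)%g) ?w1 ?mulr1 //.
by rewrite /= gh mulVg.
Qed.

Lemma char_of_level_le k k' w : (k <= k')%N -> char_of_level k w -> char_of_level k' w.
Proof.
move=> kk' [wM w1 wk]; split=> // g h gh; apply: wk.
exact: grplim_eq_le gh.
Qed.

Lemma char_of_levelP k w : continuous_character w ->
  factors_through k w <-> char_of_level k w.
Proof.
move=> wC; have [k' [wM w1 _]] := char_of_level_exists wC; split=> [[psi wE]|[_ _ wk]].
  by split=> // g h gh; rewrite !wE gh.
by exists (fun y => w (lift y)) => g; apply: wk; rewrite grp_liftE.
Qed.

Lemma charV k w g : char_of_level k w -> w (g^-1)%g = (w g)^-1.
Proof.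
move=> [wM w1 _]; have wgV : w g * w (g^-1)%g = 1 by rewrite -wM mulgV.
have wg0 : w g != 0 by apply/eqP => wg0; move/eqP: wgV; rewrite wg0 mul0r eq_sym oner_eq0.
by apply: (mulfI wg0); rewrite divff.
Qed.

Lemma charX k w g m : char_of_level k w -> w (g ^+ m)%g = w g ^+ m.
Proof. by move=> [wM w1 _]; elim: m => // m IHm; rewrite expgS wM IHm exprS. Qed.

Lemma char_exp_card k w g : char_of_level k w -> w g ^+ #|Gam k| = 1.
Proof.
move=> wk; rewrite -(charX _ _ wk); case: (wk) => _ w1 wloc; rewrite -w1.
apply: wloc; have -> : (g ^+ #|Gam k|)%g k = (g k ^+ #|Gam k|)%g.
  by elim: #|Gam k| => // m IHm; rewrite !expgS -IHm.
by rewrite -cardsT; apply: expg_cardG; rewrite inE.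
Qed.

Lemma card_Gam_neq0 k : #|Gam k|%:R != 0 :> L.
Proof.
apply: (iota_coprime_neq0 iota l_prime).
rewrite -cardsT (card_pgroup (Gam_pgroup k)) coprimeXr //.
by rewrite prime_coprime // dvdn_prime2.
Qed.

Lemma char_orthogonality k u v : char_of_level k u -> char_of_level k v ->
  \sum_(y : Gam k) u ((lift y)^-1)%g * v (lift y) = if `[< u = v >] then #|Gam k|%:R else 0.
Proof.
move=> uk vk; case: asboolP => [->|uv].
  rewrite -sum1_card natr_sum; apply: eq_bigr => y _.
  by case: vk => vM v1 _; rewrite -vM mulVg v1.
have [h uvh] : exists h, u h <> v h.
  by apply: contrapT => /forallNP uvE; apply: uv; apply/funext => h; apply: contrapT.
have u0 : u h != 0.
  have G0 : (0 < #|Gam k|)%N by apply/card_gt0P; exists 1%g.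
  apply/eqP => uh0; have := char_exp_card h uk; rewrite uh0 expr0n gtn_eqF //.
  by move/eqP; rewrite eq_sym oner_eq0.
set S := \sum_y _; have SE : u h * S = v h * S.
  rewrite {1}/S (reindex_inj (mulgI (h k))) /= !mulr_sumr; apply: eq_bigr => y _.
  have [[uM _ ul] [vM _ vl]] := (uk, vk).
  have -> : u ((lift (h k * y)%g)^-1)%g = u ((h * lift y)^-1)%g.
    by apply: ul; rewrite /= !grp_liftE.
  have -> : v (lift (h k * y)%g) = v (h * lift y)%g.
    by apply: vl; rewrite /= !grp_liftE.
  rewrite (charV _ uk) uM vM invfM (charV _ uk) !mulrA divff // mul1r.
  by congr (_ * _); rewrite mulrC.
apply/eqP; move/eqP: SE; rewrite -subr_eq0 -mulrBl mulf_eq0 subr_eq0.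
by case/orP => // /eqP.
Qed.

(** The linear extension of w to Z_l[[Gamma]], computed at the level k. *)
Definition char_eval k w x : L := \sum_(y : Gam k) iota (x k y) * w (lift y).

Lemma char_eval_le k k' w x : (k <= k')%N -> char_of_level k w ->
  char_eval k w x = char_eval k' w x.
Proof.
move=> kk' [_ _ wk]; rewrite /char_eval [RHS](partition_big (fun y => lift y k) xpredT) //=.
apply: eq_bigr => y _; rewrite (level_push tr_surj x y kk') rmorph_sum mulr_suml.
apply: eq_bigr => z /eqP zy; congr (_ * _); apply: wk.
by rewrite zy grp_liftE.
Qed.

Lemma char_eval_indep k k' w x : char_of_level k w -> char_of_level k' w ->
  char_eval k w x = char_eval k' w x.
Proof.
move=> wk wk'; have [kk'|/ltnW kk'] := leqP k k'; first exact: char_eval_le.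
by rewrite (char_eval_le x kk').
Qed.

Lemma char_eval_elt k w (a : Zl l) g : char_of_level k w ->
  char_eval k w (iwasawa_elt a g) = iota a * w g.
Proof.
move=> [_ _ wk]; rewrite /char_eval (bigD1 (g k)) //= ffunE eqxx.
rewrite big1 => [|y /negPf yg]; last by rewrite ffunE yg rmorph0 mul0r.
by rewrite addr0; congr (_ * _); apply: wk; rewrite grp_liftE.
Qed.

(** The same extension, with the proof wk among its arguments: this is what makes it
    a ring morphism. *)
Definition char_hat k w (wk : char_of_level k w) : Lambda -> L := char_eval k w.

Section CharHat.
Variables (k : nat) (w : Gamma -> L) (wk : char_of_level k w).

Lemma char_hat_is_zmod_morphism : zmod_morphism (char_hat wk).
Proof.
move=> x y; rewrite /char_hat /char_eval -sumrB; apply: eq_bigr => z _.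
by rewrite !ffunE rmorphB mulrBl.
Qed.

Lemma char_hat_is_monoid_morphism : monoid_morphism (char_hat wk).
Proof.
split=> [|x y].
  have -> : (1 : Lambda) = iwasawa_elt 1 1%g by apply: ringlim_eq.
  by rewrite /char_hat char_eval_elt // rmorph1 mul1r; case: wk.
rewrite /char_hat /char_eval mulr_suml.
under eq_bigr do rewrite ffunE rmorph_sum mulr_suml.
rewrite exchange_big; apply: eq_bigr => z _ /=.
rewrite (reindex_inj (mulgI z)) /= mulr_sumr; apply: eq_bigr => t _.
rewrite mulKg rmorphM mulrACA; congr (_ * _).
by case: wk => wM _ wl; rewrite -wM; apply: wl; rewrite /= !grp_liftE.
Qed.

HB.instance Definition _ := GRing.isZmodMorphism.Build Lambda L (char_hat wk)
  char_hat_is_zmod_morphism.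
HB.instance Definition _ := GRing.isMonoidMorphism.Build Lambda L (char_hat wk)
  char_hat_is_monoid_morphism.
End CharHat.

Lemma galois_iota s a : absolute_galois_group iota s -> s (iota a) = iota a.
Proof.
move=> [_ sQ]; apply: sQ; exists a, 1; rewrite rmorph1 divr1; split=> //.
exact: oner_neq0.
Qed.

Lemma galois_id : absolute_galois_group iota (GRing.RMorphism.clone _ _ idfun _).
Proof. by split=> //; exists id. Qed.

Lemma char_eval_galois s k w x : absolute_galois_group iota s ->
  char_eval k (s \o w) x = s (char_eval k w x).
Proof.
move=> sG; rewrite /char_eval rmorph_sum; apply: eq_bigr => y _.
by rewrite rmorphM galois_iota.
Qed.

Lemma char_of_level_galois (s : {rmorphism L -> L}) k w :
  char_of_level k w -> char_of_level k (s \o w).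
Proof.
move=> [wM w1 wk]; split=> [g h||g h gh] /=; first by rewrite wM rmorphM.
  by rewrite w1 rmorph1.
by rewrite (wk _ _ gh).
Qed.

End Characters.

Section OrbitIdempotents.
Variables (l p : nat) (Gam : nat -> finGroupType)
  (tr : forall n, {morphism [set: Gam n.+1]%SET >-> Gam n}).
Variables (L : closedFieldType) (iota : {rmorphism Zl l -> L}).
Hypotheses (l_prime : prime l) (p_prime : prime p) (l_neq_p : l != p).
Hypothesis Gam_pgroup : forall n, (p.-group [set: Gam n]%SET)%g.
Hypothesis tr_surj : forall n (y : Gam n), exists x, tr n x = y.
Hypothesis iota_inj : injective iota.

Local Notation Lambda := (Iwasawa l tr).
Local Notation Gamma := (grplim tr).
Local Notation lift := (grp_lift tr).
Local Notation orbit w := (galois_orbit iota w).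
Local Notation e w := (orbit_idempotent iota (orbit w)).
Implicit Types (w v u : Gamma -> L) (x : Lambda) (g h : Gamma).

(** The values of a character of Gam k are roots of X ^ |Gam k| - 1. *)
Lemma finite_characters k : finite_set [set w : Gamma -> L | char_of_level k w].
Proof.
have [rs rsE] := closed_field_poly_normal ('X^#|Gam k| - 1 : {poly L}).
have G0 : (0 < #|Gam k|)%N by apply/card_gt0P; exists 1%g.
rewrite lead_coefDl ?size_polyXn ?size_polyN ?size_poly1 // lead_coefXn scale1r in rsE.
pose F (f : {ffun Gam k -> seq_sub rs}) (g : Gamma) : L := val (f (g k)).
apply: (@sub_finite_set _ _ (F @` setT)); last exact/finite_image/finite_finset.
move=> w wk /=; have w_rs g : w g \in rs.
  have : root ('X^#|Gam k| - 1) (w g).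
    by rewrite rootE !hornerE (char_exp_card _ wk) subrr.
  by rewrite rsE root_prod_XsubC.
exists [ffun y => SeqSub (w_rs (lift y))] => //; apply/funext => g.
by rewrite /F ffunE /=; case: wk => _ _; apply; rewrite grp_liftE.
Qed.

Lemma orbit_self w : orbit w w.
Proof. by exists (GRing.RMorphism.clone _ _ idfun _) => //; apply: galois_id. Qed.

Lemma orbit_sub w v : orbit w v -> orbit v `<=` orbit w.
Proof.
move=> [s [sbij sQ] <-] _ [t [tbij tQ] <-].
exists (GRing.RMorphism.clone _ _ (t \o s) _) => //; split; first exact: bij_comp.
by move=> z zQ /=; rewrite sQ // tQ.
Qed.

Lemma orbit_eq w v : orbit w v -> orbit v = orbit w.
Proof.
move=> wv; apply/seteqP; split; first exact: orbit_sub.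
apply: orbit_sub; case: wv => s [[t st ts] sQ] <-.
pose t' : {rmorphism L -> L} := HB.pack t
  (GRing.isZmodMorphism.Build _ _ t (can2_zmod_morphism st ts))
  (GRing.isMonoidMorphism.Build _ _ t (can2_monoid_morphism st ts)).
exists t'; last by apply/funext => g /=; rewrite st.
by split=> [|z zQ]; [exists s|rewrite -{1}(sQ z zQ) [t' _]st].
Qed.

Lemma orbit_level k w v : char_of_level k w -> orbit w v -> char_of_level k v.
Proof. by move=> wk [s _ <-]; apply: char_of_level_galois. Qed.

Lemma finite_orbit w : continuous_character w -> finite_set (orbit w).
Proof.
move=> /char_of_level_exists[k wk]; apply: sub_finite_set (finite_characters k).
by move=> v /orbit_level; apply.
Qed.

Lemma in_orbit w v : continuous_character w ->
  (v \in fset_set (orbit w)) = `[< orbit w v >].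
Proof. by move=> /finite_orbit fin; rewrite in_fset_set. Qed.

Lemma factors_of_level k w : char_of_level k w -> factors_through k w.
Proof.
by move=> [_ _ wk]; exists (fun y => w (lift y)) => g; apply: wk; rewrite grp_liftE.
Qed.

(** By its definition, e_w is either 0 or the element with these coefficients. The
    identities below hold in both cases. *)
Lemma orbit_idempotentP w : continuous_character w -> e w <> 0 ->
  (forall k g, char_of_level k w ->
    iota (e w k (g k)) = \sum_(v <- fset_set (orbit w)) (#|Gam k|%:R)^-1 * v (g^-1)%g) /\
  (forall k, ~ char_of_level k w -> e w k = 0).
Proof.
move=> wC; rewrite /orbit_idempotent; set P := (X in xget 0 X) => e_neq0.
have [E PE] : exists E, P E.
  by apply: contrapT => /forallNP nP; apply: e_neq0; apply: xgetPN.
have eP : P (xget 0 P) by apply: (xgetPex 0); exists E.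
split=> [k g wk|k wk].
  rewrite -fsbig_finite; last exact: finite_orbit.
  apply: (eP k).1 => v wv; apply: factors_of_level; exact: orbit_level wv.
by apply: (eP k).2 => h; apply: wk; apply/(char_of_levelP tr_surj _ wC)/h/orbit_self.
Qed.

Section Orbit.
Variables (w : Gamma -> L) (wC : continuous_character w).

(** x times the idempotent of a character v is v(x) times this idempotent, and e_w
    is the sum of these idempotents for v in the orbit of w. *)
Lemma mul_idempotentE x k g : char_of_level k w -> e w <> 0 ->
  iota ((x * e w) k (g k)) =
  \sum_(v <- fset_set (orbit w)) (#|Gam k|%:R)^-1 * v (g^-1)%g * char_eval iota k v x.
Proof.
move=> wk e_neq0; have [eE _] := orbit_idempotentP wC e_neq0.
have wO v : v \in fset_set (orbit w) -> char_of_level k v.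
  by rewrite in_orbit // => /asboolP; apply: orbit_level.
rewrite ffunE rmorph_sum /=.
transitivity (\sum_(y : Gam k) \sum_(v <- fset_set (orbit w))
    (#|Gam k|%:R)^-1 * v (g^-1)%g * (iota (x k y) * v (lift y))).
  apply: eq_bigr => y _; rewrite rmorphM.
  have -> : (y^-1 * g k)%g = ((lift y)^-1 * g)%g k by rewrite /= grp_liftE.
  rewrite eE // mulr_sumr big_seq [RHS]big_seq; apply: eq_bigr => v /wO[vM _ _].
  by rewrite invMg invgK vM mulrCA -!mulrA; congr (_ * _); rewrite mulrCA.
rewrite exchange_big; apply: eq_bigr => v _ /=.
by rewrite -mulr_sumr.
Qed.

(** The values of x at the conjugates of w are conjugate to its value at w. *)
Lemma mul_idempotent_eq0 x k : char_of_level k w -> char_eval iota k w x = 0 ->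
  x * e w = 0.
Proof.
move=> wk xw0; have [->|/eqP e_neq0] := eqVneq (e w) 0; first by rewrite mulr0.
apply: ringlim_eq => k'; have [wk'|wk'] := pselect (char_of_level k' w); last first.
  rewrite -[LHS]/(x k' * e w k') (orbit_idempotentP wC e_neq0).2 //.
  exact: mulr0.
apply/ffunP => y; rewrite -[y in LHS](grp_liftE tr_surj) [RHS]ffunE; apply: iota_inj.
rewrite mul_idempotentE // rmorph0 big_seq big1 // => v.
rewrite in_orbit // => /asboolP[s sG <-]; rewrite (char_eval_galois _ _ _ sG).
by rewrite (char_eval_indep iota tr_surj x wk' wk) xw0 rmorph0 mulr0.
Qed.

Lemma char_eval_idempotent k v : char_of_level k w -> char_of_level k v ->
  e w <> 0 -> char_eval iota k v (e w) = if `[< orbit w v >] then 1 else 0.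
Proof.
move=> wk vk e_neq0; have [eE _] := orbit_idempotentP wC e_neq0.
have wO u := in_orbit u wC.
transitivity (\sum_(u <- fset_set (orbit w)) if `[< u = v >] then 1 else 0 : L).
  transitivity (\sum_(y : Gam k) \sum_(u <- fset_set (orbit w))
     (#|Gam k|%:R)^-1 * (u ((lift y)^-1)%g * v (lift y))).
    apply: eq_bigr => y _; rewrite -{1}[y](grp_liftE tr_surj) eE // mulr_suml.
    by apply: eq_bigr => u _; rewrite mulrA.
  rewrite exchange_big big_seq [RHS]big_seq; apply: eq_bigr => u.
  rewrite wO => /asboolP wu; rewrite -mulr_sumr.
  rewrite (char_orthogonality tr_surj) //; last first.
    exact: orbit_level wu.
  by case: asboolP => _; rewrite ?mulr0 // mulVf // (card_Gam_neq0 iota l_prime p_prime).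
case: asboolP => [/asboolP|/asboolP/negPf] wv.
  rewrite (bigD1_seq v) ?wO ?fset_uniq //= big1 => [|u /eqP uv]; last first.
    by case: asboolP.
  by rewrite addr0; case: asboolP.
rewrite big_seq big1 // => u; rewrite wO; case: asboolP => // wu _.
by case: asboolP => // uv; move: wv; rewrite -uv; case: asboolP.
Qed.

Lemma orbit_idempotent_idem : e w * e w = e w.
Proof.
have [->|/eqP e_neq0] := eqVneq (e w) 0; first by rewrite mulr0.
have [k wk] := char_of_level_exists wC.
apply/eqP; rewrite -subr_eq0 -{3}[e w]mul1r -mulrBl; apply/eqP.
apply: mul_idempotent_eq0 (wk) _.
transitivity (char_eval iota k w (e w) - 1).
  by rewrite -[LHS]/(char_hat iota wk (e w - 1)) rmorphB rmorph1.
rewrite char_eval_idempotent //; case: asboolP => [_|]; first by rewrite subrr.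
by move/(_ (orbit_self w)).
Qed.

End Orbit.

Lemma orbit_idempotent_orth w v : continuous_character w -> continuous_character v ->
  orbit w <> orbit v -> e w * e v = 0.
Proof.
move=> wC vC wv; have [->|/eqP e_neq0] := eqVneq (e w) 0; first by rewrite mul0r.
have [k1 wk1] := char_of_level_exists wC; have [k2 vk2] := char_of_level_exists vC.
have wk := char_of_level_le (leq_addr k2 k1) wk1.
have vk := char_of_level_le (leq_addl k1 k2) vk2.
apply: (mul_idempotent_eq0 vC vk).
rewrite char_eval_idempotent //; case: asboolP => // /orbit_eq vw.
by case: wv.
Qed.

Lemma finite_nonzero_idempotents k : finite_set
  [set O | galois_orbits iota O /\ (orbit_idempotent iota O : Lambda) k <> 0].
Proof.
apply: sub_finite_set (finite_image (galois_orbit iota) (finite_characters k)).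
move=> _ [[w wC <-] ewk]; exists w => //=; apply: contrapT => wk; apply: ewk.
have [->//|/eqP e_neq0] := eqVneq (e w) 0.
by rewrite (orbit_idempotentP wC e_neq0).2.
Qed.

End OrbitIdempotents.

(** * The components of a module *)

Section Components.
Variables (l p : nat) (Gam : nat -> finGroupType)
  (tr : forall n, {morphism [set: Gam n.+1]%SET >-> Gam n}).
Variables (L : closedFieldType) (iota : {rmorphism Zl l -> L}).
Hypotheses (l_prime : prime l) (p_prime : prime p) (l_neq_p : l != p).
Hypothesis Gam_abelian : forall n, abelian [set: Gam n]%SET.
Hypothesis Gam_pgroup : forall n, (p.-group [set: Gam n]%SET)%g.
Hypothesis tr_surj : forall n (y : Gam n), exists x, tr n x = y.
Hypothesis iota_inj : injective iota.
Variable M : lmodType (Iwasawa l tr).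

Local Notation Lambda := (Iwasawa l tr).
Local Notation Gamma := (grplim tr).
Local Notation lift := (grp_lift tr).
Local Notation orbit w := (galois_orbit iota w).
Local Notation e w := (orbit_idempotent iota (orbit w)).
Local Notation MZ := (restrict_scalars (@Zl_Iwasawa l Gam tr) M).
Local Notation elt g := (iwasawa_elt 1 g : Lambda).
Implicit Types (w v u : Gamma -> L) (x : Lambda) (g h : Gamma).

Lemma MZ_scaleE (c : Zl l) (m : MZ) : c *: m = Zl_Iwasawa tr c *: (m : M).
Proof. by []. Qed.

Definition Iwasawa_act (x : Lambda) (m : MZ) : MZ := x *: (m : M).

Lemma Iwasawa_act_is_linear x : linear (Iwasawa_act x).
Proof.
move=> c m n; rewrite -[LHS]/(x *: (Zl_Iwasawa tr c *: (m : M) + n)).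
by rewrite scalerDr scalerA (Iwasawa_mulC Gam_abelian x) -scalerA.
Qed.

HB.instance Definition _ x :=
  GRing.isLinear.Build (Zl l) MZ MZ _ (Iwasawa_act x) (Iwasawa_act_is_linear x).

Local Notation comp w := (component (e w) M : set MZ).

Lemma component_act a x (m : M) : component a M m -> component a M (x *: m).
Proof.
move=> [m' _ <-]; exists (x *: m') => //.
by rewrite !scalerA (Iwasawa_mulC Gam_abelian).
Qed.

Lemma component_submodule a : submodule (component a M : set MZ).
Proof.
split; [split|].
- by exists 0; rewrite ?scaler0.
- by move=> _ _ [m _ <-] [n _ <-]; exists (m - n); rewrite ?scalerBr.
- by move=> c m ma; apply: component_act.
Qed.

Section OneComponent.
Variables (w : Gamma -> L) (wC : continuous_character w).

Let idem : e w * e w = e w.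
Proof.
exact: (orbit_idempotent_idem l_prime p_prime l_neq_p Gam_pgroup tr_surj iota_inj wC).
Qed.

Lemma component_fixed (m : M) : comp w m -> e w *: m = m.
Proof. by move=> [m' _ <-]; rewrite scalerA idem. Qed.

(** On M_w, an element x of Z_l[[Gamma]] acts through its component in
    Z_l[Gam k], where k is a level of w. *)
Lemma component_act_level k x (m : M) : char_of_level k w -> comp w m ->
  x *: m = level_approx k x *: m.
Proof.
move=> wk /component_fixed mE; apply/eqP; rewrite -subr_eq0 -scalerBl -mE scalerA.
rewrite (mul_idempotent_eq0 tr_surj iota_inj wC wk) ?scale0r //.
transitivity (char_eval iota k w x - char_eval iota k w (level_approx k x)).
  exact: (rmorphB (char_hat iota wk)).
by rewrite /char_eval level_approxE // subrr.
Qed.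

Lemma component_fin_gen :
  finitely_generated (component (e w) Lambda^o) (component (e w) M) ->
  fin_gen (comp w).
Proof.
move=> [r [m [mw mM]]]; have [k wk] := char_of_level_exists wC.
exists ('I_r * Gam k)%type, (fun ig => elt (lift ig.2) *: m ig.1 : M).
apply/seteqP; split=> [y /mM[a aw ->]|_ [c ->]]; last first.
  apply: submodule_sum; first exact: component_submodule.
  by move=> [i g]; apply: component_act.
exists (fun ig => a ig.1 k ig.2).
rewrite -(pair_bigA _ (fun i (g : Gam k) => a i k g *: (elt (lift g) *: m i : MZ))) /=.
apply: eq_bigr => i _; rewrite (component_act_level (a i) wk (mw i)).
rewrite /level_approx scaler_suml; apply: eq_bigr => g _.
by rewrite MZ_scaleE scalerA iwasawa_eltM mulr1 mul1g.
Qed.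

(** If a m = 0 with a nonzero in e_w Z_l[[Gamma]], then some multiple of a is a
    nonzero element of Z_l: the image of a in L is integral over Z_l. *)
Lemma component_torsion :
  torsion_over (component (e w) Lambda^o) (component (e w) M) ->
  comp w `<=` @l_torsion l MZ.
Proof.
move=> wT m mw; have [_ [x _ <-] [a_neq0 am]] := wT m mw.
have {am} xm : x *: m = 0.
  rewrite -am -[in LHS](component_fixed mw) scalerA.
  by rewrite (Iwasawa_mulC Gam_abelian).
have [k wk] := char_of_level_exists wC.
pose alpha := char_hat iota wk x.
have alpha0 : alpha != 0.
  apply: contra_neq a_neq0 => alpha0.
  rewrite -[LHS]/(e w * x) (Iwasawa_mulC Gam_abelian).
  exact: (mul_idempotent_eq0 tr_surj iota_inj wC wk).
have pows t : exists c : Gam k -> Zl l, alpha ^+ t = \sum_y iota (c y) * w (lift y).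
  by exists ((x ^+ t) k); rewrite /alpha -rmorphXn.
have [c c0 [r [q cE]]] := multiple_in_Zl l_prime pows alpha0.
pose b : Lambda := \sum_i Zl_Iwasawa tr (q i) * x ^+ i.
have cm : Zl_Iwasawa tr c *: m = 0.
  have -> : Zl_Iwasawa tr c *: m = (x * b) *: m.
    apply/eqP; rewrite -subr_eq0 -scalerBl -(component_fixed mw) scalerA.
    rewrite (mul_idempotent_eq0 tr_surj iota_inj wC wk) ?scale0r //.
    rewrite -[LHS]/(char_hat iota wk _) rmorphB rmorphM rmorph_sum /= -/alpha.
    have hatZ a : char_hat iota wk (Zl_Iwasawa tr a) = iota a.
      by have [_ w1 _] := wk; rewrite /char_hat char_eval_elt // w1 mulr1.
    rewrite hatZ cE; apply/eqP; rewrite subr_eq0; apply/eqP; congr (_ * _).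
    by apply: eq_bigr => i _; rewrite rmorphM rmorphXn /= hatZ.
  by rewrite (Iwasawa_mulC Gam_abelian) -scalerA xm scaler0.
have [n [u [u0 cu]]] := Zl_factor l_prime c0; have [t tu] := Zl_unit l_prime u0.
have cE' : l%:R ^+ n = t * c by rewrite cu mulrCA tu mulr1.
by exists n; rewrite -scale_lX cE' MZ_scaleE rmorphM -scalerA cm scaler0.
Qed.

(** Let gam be such that w gam is a primitive root of unity of order p ^ n. Its
    action on M_w is annihilated by the cyclotomic polynomial of order p ^ n, since
    w and its conjugates take it to roots of this polynomial. *)
Lemma component_quot_card K n q : natural_submodule K -> range w = mu (p ^ n) ->
  quot_card (comp w) (K MZ (comp w)) q -> (q = 1 %[mod p ^ n])%N.
Proof.
move=> Kn wmu; case: n wmu => [|n] wmu; first by rewrite expn0 !modn1.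
have [z z_prim] := primitive_root_exists iota l_prime p_prime l_neq_p n.+1.
have [gam _ wgam] : range w z.
  by rewrite wmu; exact: (prim_expr_order z_prim).
have [k wk] := char_of_level_exists wC.
have iterE j (m : MZ) : iter j (Iwasawa_act (elt gam)) m = elt (gam ^+ j)%g *: (m : M).
  elim: j => [|j IHj]; first by rewrite expg0 -/(Zl_Iwasawa tr 1) rmorph1 scale1r.
  rewrite iterS IHj -[LHS]/(elt gam *: (elt (gam ^+ j)%g *: (m : M))).
  by rewrite scalerA iwasawa_eltM mulr1 expgS.
have hat_elt j : char_eval iota k w (elt (gam ^+ j)%g) = z ^+ j.
  by rewrite char_eval_elt // rmorph1 mul1r (charX _ _ wk) wgam.
have act0 x (m : M) : char_hat iota wk x = 0 -> comp w m -> x *: m = 0.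
  move=> x0 /component_fixed <-; rewrite scalerA.
  by rewrite (mul_idempotent_eq0 tr_surj iota_inj wC wk) ?scale0r.
apply: (@quot_card_free l l_prime K MZ (comp w) (Iwasawa_act (elt gam)) p n) => //.
- exact: component_submodule.
- by move=> m mw; apply: component_act.
- move=> m mw; rewrite iterE.
  have : (elt (gam ^+ (p ^ n.+1))%g - 1 : Lambda) *: (m : M) = 0.
    apply: act0 => //; rewrite rmorphB rmorph1 /= /char_hat hat_elt.
    by rewrite (prim_expr_order z_prim) subrr.
  by rewrite scalerBl scale1r => /subr0_eq.
- move=> m mw; under eq_bigr do rewrite iterE.
  transitivity ((\sum_(i < p) elt (gam ^+ (i * p ^ n))%g : Lambda) *: (m : M)).
    by rewrite scaler_suml.
  apply: act0 => //; rewrite rmorph_sum /=.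
  under eq_bigr do rewrite /char_hat hat_elt.
  have u1 : z ^+ (p ^ n) != 1.
    rewrite -(prim_order_dvd z_prim) gtnNdvd ?expn_gt0 ?prime_gt0 //.
    by rewrite ltn_exp2l ?prime_gt1.
  apply: (mulfI (x := z ^+ (p ^ n) - 1)); first by rewrite subr_eq0.
  under eq_bigr do rewrite mulnC exprM.
  by rewrite -subrX1 mulr0 -exprM -expnSr (prim_expr_order z_prim) subrr.
Qed.

End OneComponent.

(** Completeness makes the convergent sum of idempotents act as the finite sum of
    those that do not annihilate M. *)
Lemma epsilon_act n : sinnott_module iota p M ->
  (forall m : M, epsilon tr iota p n *: m = 0) \/
  forall m : M, epsilon tr iota p n *: m =
    \sum_(O \in [set O | orbits_of_level iota p n O /\
                         component (orbit_idempotent iota O) M <> [set 0]])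
      (orbit_idempotent iota O *: m).
Proof.
move=> [_ [sep _] fin]; set F := [set O | _ /\ _].
have finF : finite_set F by apply: fin.
rewrite /epsilon; set P := (X in xget 0 X).
have [[E0 PE0]|/forallNP nP] := pselect (exists E, P E); last first.
  by left=> m; rewrite xgetPN ?scale0r.
right=> m; have : P (xget 0 P) by apply: (xgetPex 0); exists E0.
move: (xget 0 P) => E PE.
apply/eqP; rewrite -subr_eq0; apply/eqP; apply: sep => k.
have S_orbits O : orbits_of_level iota p n O -> galois_orbits iota O.
  by move=> [w [wC _] <-]; exists w.
pose S := orbits_of_level (tr := tr) iota p n.
pose G : set (set (Gamma -> L)) :=
  [set O | S O /\ (orbit_idempotent iota O : Lambda) k <> 0].
have finG : finite_set G.
  apply: sub_finite_set (finite_nonzero_idempotents iota tr_surj k).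
  by move=> O [/S_orbits SO eO].
pose H := F `|` G; have finH : finite_set H by rewrite finite_setU.
have HS : H `<=` S by move=> O [[]|[]].
pose D : Lambda := E - \sum_(O <- fset_set H) orbit_idempotent iota O.
have Dk : D k = 0.
  rewrite -[LHS]/(E k - (\sum_(O <- fset_set H) orbit_idempotent iota O : Lambda) k).
  rewrite ringlim_sum PE -fsbig_finite //; apply/eqP; rewrite subr_eq0; apply/eqP.
  apply/esym/fsbig_widen => // O [SO nH] /=; apply: contrapT => eO.
  by apply: nH; right.
exists 1%N, (fun=> D), (fun=> m); split=> [_|]; first exact: kernel_sub_I_ideal.
rewrite big_ord1 scalerBl scaler_suml -fsbig_finite //; congr (_ - _).
apply: fsbig_widen => [O FO|O [HO nF] /=]; first by left.
apply: contrapT => eOm; apply: nF; split; first exact: HS.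
move=> e0; apply: eOm.
have : component (orbit_idempotent iota O) M (orbit_idempotent iota O *: m).
  by exists m.
by rewrite e0.
Qed.

Lemma epsilon_decomposition n : sinnott_module iota p M ->
  exists (J : finType) (w : J -> Gamma -> L),
    (forall j, continuous_character (w j) /\ range (w j) = mu (p ^ n)) /\
    direct_sum_decomposition (component (epsilon tr iota p n) M : set MZ)
      (fun j => comp (w j)) (fun=> idfun) (fun j => Iwasawa_act (e (w j))).
Proof.
move=> sM; have [eps0|] := epsilon_act n sM.
  exists void, (@of_void _); split=> [[]//|]; split=> //.
  by move=> _ [m _ <-]; rewrite eps0 big1 // => -[].
set F := [set O | _ /\ _] => epsE.
have finF : finite_set F by case: sM => _ _; apply.
have wE (j : fset_set F) : {w : Gamma -> L | continuous_character w /\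
    range w = mu (p ^ n) & galois_orbit iota w = val j}.
  apply: cid2; have : val j \in fset_set F by apply: valP.
  by rewrite in_fset_set // => /set_mem[[w wP wj] _]; exists w.
pose w j := s2val (wE j).
have wC j : continuous_character (w j) by case: (s2valP (wE j)).
have wmu j : range (w j) = mu (p ^ n) by case: (s2valP (wE j)).
have wO j : orbit (w j) = val j by exact: s2valP' (wE j).
have {}epsE (m : M) : epsilon tr iota p n *: m = \sum_j e (w j) *: m.
  rewrite epsE fsbig_finite // big_seq_fsetE /=.
  by apply: eq_bigr => j _; rewrite wO.
have orth i j (m : M) : comp (w i) m -> e (w j) *: m = if i == j then m else 0.
  move=> mi; case: eqP => [<-|ij]; first exact: component_fixed.
  rewrite -(component_fixed (wC i) mi) scalerA.
  rewrite (orbit_idempotent_orth l_prime p_prime l_neq_p Gam_pgroup tr_surj iota_inj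
    (wC j) (wC i)) ?scale0r //.
  by rewrite !wO => /val_inj ji; apply: ij.
exists (fset_set F), w; split=> //; split.
- move=> j m mj; exists m => //; rewrite epsE (bigD1 j) //= (orth j) // eqxx.
  rewrite big1 ?addr0 // => i /negPf ij; rewrite (orth j) //.
  by rewrite eq_sym ij.
- by move=> j m _; exists m.
- move=> _ [m _ <-]; rewrite -[LHS]/(\sum_j e (w j) *: (epsilon tr iota p n *: m)).
  rewrite epsE; apply: eq_bigr => j _; rewrite scaler_sumr (bigD1 j) //=.
  rewrite (orth j) ?eqxx; last by exists m.
  rewrite big1 ?addr0 // => i /negPf ij; rewrite (orth i) ?ij //.
  by exists m.
- by move=> i j m mi; apply: orth.
Qed.

End Components.

(** * Ranks and cardinalities of the layers *)

Section FinfunModules.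
Variables (R S : pzRingType) (f : {rmorphism R -> S}) (M : lmodType S) (I : finType).
Local Notation MZ := (restrict_scalars f M).
Local Notation FZ := (restrict_scalars f {ffun I -> M}).

Definition ffun_inj (j : I) (m : MZ) : FZ := [ffun i => if i == j then (m : M) else 0].
Definition ffun_prj (j : I) (x : FZ) : MZ := (x : {ffun I -> M}) j.

Lemma ffun_inj_is_linear j : linear (ffun_inj j).
Proof.
move=> c m n; apply/ffunP => i; rewrite !ffunE.
by case: eqP => // _; rewrite scaler0 addr0.
Qed.

Lemma ffun_prj_is_linear j : linear (ffun_prj j).
Proof. by move=> c x y; rewrite /ffun_prj !ffunE. Qed.

HB.instance Definition _ j :=
  GRing.isLinear.Build R MZ FZ _ (ffun_inj j) (ffun_inj_is_linear j).
HB.instance Definition _ j :=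
  GRing.isLinear.Build R FZ MZ _ (ffun_prj j) (ffun_prj_is_linear j).
End FinfunModules.

Section Invariants.
Variable l : nat.
Hypothesis l_prime : prime l.

Definition Zl_rank_of (V : lmodType (Zl l)) (N : set V) : nat :=
  max_nat [set j | exists x : 'I_j -> V, (forall i, N (x i)) /\
    forall c : 'I_j -> Zl l, \sum_i c i *: x i = 0 -> forall i, c i = 0].

Definition l_rank_of (V : lmodType (Zl l)) (N : set V) : nat :=
  max_nat [set j | exists x : 'I_j -> V, (forall i, N (x i)) /\
    forall c : 'I_j -> 'F_l,
      [set y *+ l | y in N] (\sum_i x i *+ (c i : nat)) -> forall i, c i = 0].

Definition length_of (V : lmodType (Zl l)) (N : set V) : nat := card_valuation l N.

(** The boolean t lets the same lemmas serve for the ranks, which are considered for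
    all finitely generated modules, and for the length, for torsion ones. *)
Definition fin_gen_tors (t : bool) (V : lmodType (Zl l)) (N : set V) :=
  fin_gen N /\ (t -> N `<=` @l_torsion l V).

Definition log_invariant (t : bool) (K : forall V : lmodType (Zl l), set V -> set V)
    (X : forall V : lmodType (Zl l), set V -> nat) :=
  natural_submodule K /\
  forall V N, fin_gen_tors t N -> quot_card N (K V N) (l ^ X V N).

Lemma Zl_rank_log : log_invariant false (fun V N => l_multiples_tors l N) Zl_rank_of.
Proof.
split=> [|V N [fgN _]]; first exact: l_multiples_tors_natural.
by have [k [qN kE]] := Zl_rank_of_quot_card l_prime fgN; rewrite /Zl_rank_of kE.
Qed.

Lemma l_rank_log : log_invariant false (fun V N => l_multiples l N) l_rank_of.
Proof.
split=> [|V N [fgN _]]; first exact: l_multiples_natural.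
by have [k [qN kE]] := l_rank_of_quot_card l_prime fgN; rewrite /l_rank_of kE.
Qed.

Lemma length_log : log_invariant true (fun V N => [set 0]) length_of.
Proof.
split=> [|V N [fgN Ntors]]; first exact: zero_natural.
have [v qN] := quot_card_torsion l_prime fgN (Ntors isT).
by rewrite /length_of /card_valuation (quot_card_fset_set qN).2 pfactorK.
Qed.

Lemma fin_gen_tors_direct_sum t (V W : lmodType (Zl l)) (J : finType) (N : set V)
    (Nj : J -> set W) (inj : J -> {linear W -> V}) (prj : J -> {linear V -> W}) :
    direct_sum_decomposition N Nj inj prj -> submodule N ->
  (forall j, fin_gen_tors t (Nj j)) -> fin_gen_tors t N.
Proof.
move=> sumN mN Njt; split; first by apply: fin_gen_direct_sum sumN mN _ => j; case: (Njt j).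
move=> tT x Nx; rewrite -(dsum_prjK sumN Nx).
apply: (subgroup_sum (l_torsion_submodule V).1) => j _.
have [_ /(_ tT) Ntors] := Njt j; have [m xm] := Ntors _ (dsum_prj sumN j Nx).
by exists m; rewrite -raddfMn xm raddf0.
Qed.

Section Additivity.
Variables (t : bool) (K : forall V : lmodType (Zl l), set V -> set V).
Variable X : forall V : lmodType (Zl l), set V -> nat.
Hypothesis KX : log_invariant t K X.

Lemma log_invariant_direct_sum (V W : lmodType (Zl l)) (J : finType) (N : set V)
    (Nj : J -> set W) (inj : J -> {linear W -> V}) (prj : J -> {linear V -> W}) :
    direct_sum_decomposition N Nj inj prj -> submodule N ->
  (forall j, fin_gen_tors t (Nj j)) -> X N = (\sum_j X (Nj j))%N.
Proof.
move=> sumN mN Njt; have Nt := fin_gen_tors_direct_sum sumN mN Njt.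
have [Kn XE] := KX.
have qN : quot_card N (K N) (\prod_j l ^ X (Nj j)).
  by apply: quot_card_direct_sum sumN mN _ _ Kn _ => j; apply: XE.
have sK := (Kn.1 _ _ mN).1.
apply/eqP; rewrite -(eqn_exp2l _ _ (prime_gt1 l_prime)) expn_sum; apply/eqP.
exact: quot_card_unique sK (XE _ _ Nt) qN.
Qed.

End Additivity.
End Invariants.

Section Layers.
Variables (l p : nat) (Gam : nat -> finGroupType)
  (tr : forall n, {morphism [set: Gam n.+1]%SET >-> Gam n}).
Variables (L : closedFieldType) (iota : {rmorphism Zl l -> L}).
Hypotheses (l_prime : prime l) (p_prime : prime p) (l_neq_p : l != p).
Hypothesis Gam_abelian : forall n, abelian [set: Gam n]%SET.
Hypothesis Gam_pgroup : forall n, (p.-group [set: Gam n]%SET)%g.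
Hypothesis tr_surj : forall n (y : Gam n), exists x, tr n x = y.
Hypothesis iota_inj : injective iota.
Variable M : lmodType (Iwasawa l tr).
Hypothesis M_sinnott : sinnott_module iota p M.
Variable t : bool.
Hypothesis M_torsion : t -> torsion_module iota M.

Local Notation phi := (@Zl_Iwasawa l Gam tr).
Local Notation MZ := (restrict_scalars phi M).
Local Notation layer n := (component (epsilon tr iota p n) M : set MZ).
Local Notation layers n := (direct_sum (fun m => component (epsilon tr iota p m) M) n
  : set (restrict_scalars phi {ffun 'I_n.+1 -> M})).

Lemma component_fin_gen_tors w : continuous_character w ->
  fin_gen_tors t (component (orbit_idempotent iota (galois_orbit iota w)) M : set MZ).
Proof.
move=> wC; have wO : galois_orbits iota (galois_orbit iota w) by exists w.
split.
  apply: (component_fin_gen l_prime p_prime l_neq_p Gam_abelian Gam_pgroup tr_surj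
    iota_inj wC).
  exact: sinnott_locally_fg M_sinnott _ wO.
move=> /M_torsion Mt.
apply: (component_torsion l_prime p_prime l_neq_p Gam_abelian Gam_pgroup tr_surj
  iota_inj wC).
exact: Mt.
Qed.

Lemma layer_fin_gen_tors n : fin_gen_tors t (layer n).
Proof.
have [J [w [wP sumN]]] := epsilon_decomposition l_prime p_prime l_neq_p Gam_abelian
  Gam_pgroup tr_surj iota_inj n M_sinnott.
apply: (fin_gen_tors_direct_sum sumN); first exact: component_submodule.
by move=> j; apply: component_fin_gen_tors; case: (wP j).
Qed.

Variables (K : forall V : lmodType (Zl l), set V -> set V).
Variable X : forall V : lmodType (Zl l), set V -> nat.
Hypothesis KX : log_invariant t K X.

(** Each component M_w of the layer satisfies l ^ X = 1 modulo p ^ n, and the degree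
    is the order of l modulo p ^ n. *)
Lemma cyclotomic_degree_dvd_layer n : (cyclotomic_degree iota p n %| X (layer n))%N.
Proof.
have [J [w [wP sumN]]] := epsilon_decomposition l_prime p_prime l_neq_p Gam_abelian
  Gam_pgroup tr_surj iota_inj n M_sinnott.
rewrite (log_invariant_direct_sum l_prime KX sumN) //; first last.
- by move=> j; apply: component_fin_gen_tors; case: (wP j).
- exact: component_submodule.
apply: dvdn_sum => j _; have [wC wmu] := wP j.
have [_ <-] := order_mod_cyclotomic_degree n l_prime p_prime l_neq_p iota_inj.
apply/eqP; apply: (component_quot_card l_prime p_prime l_neq_p Gam_abelian
  Gam_pgroup tr_surj iota_inj wC KX.1 wmu).
by apply: KX.2; apply: component_fin_gen_tors.
Qed.

Lemma layers_decomposition n :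
  direct_sum_decomposition (layers n) (fun m : 'I_n.+1 => layer m)
    (@ffun_inj _ _ phi M _) (@ffun_prj _ _ phi M _).
Proof.
split.
- move=> m x xm i; rewrite ffunE; case: eqP => [->//|_].
  exact: (subgroup0 (component_submodule Gam_abelian M _).1).
- by move=> m x xN; apply: xN.
- move=> x xN; apply/ffunP => i; rewrite sum_ffunE (bigD1 i) //= ffunE eqxx.
  by rewrite big1 ?addr0 // => j /negPf ji; rewrite ffunE eq_sym ji.
- move=> i j x xi; rewrite -[LHS]/([ffun k => if k == i then (x : M) else 0] j).
  by rewrite ffunE eq_sym.
Qed.

Lemma layers_submodule n : submodule (layers n).
Proof.
have mN m := component_submodule Gam_abelian M (epsilon tr iota p m).
split; [split|].
- by move=> m; rewrite ffunE; apply: subgroup0 (mN m).1.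
- by move=> x y xN yN m; rewrite !ffunE; apply: subgroupB (mN m).1 _ _ (xN m) (yN m).
- by move=> c x xN m; rewrite ffunE; apply: (mN m).2 _ _ (xN m).
Qed.

Lemma layers_sum n : X (layers n) = (\sum_(0 <= m < n.+1) X (layer m))%N.
Proof.
rewrite (log_invariant_direct_sum l_prime KX (layers_decomposition n) (layers_submodule n)).
  by rewrite big_mkord.
by move=> m; apply: layer_fin_gen_tors.
Qed.

Lemma layer_formulas_log_invariant n :
  let f := cyclotomic_degree iota p in
  let r m : rat := (X (layer m))%:R / (f m)%:R in
  r n \is a Num.nat /\
  layer_formulas l p (a_const l p (f 1%N)) f r n (X (layers n))%:R.
Proof.
move=> f r; have fE m := order_mod_cyclotomic_degree m l_prime p_prime l_neq_p iota_inj.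
have f0 m : (f m)%:R != 0 :> rat by rewrite pnatr_eq0 -lt0n; case: (fE m).
split.
  have /dvdnP[q qE] := cyclotomic_degree_dvd_layer n.
  by rewrite /r qE natrM mulfK // natr_nat.
apply: layer_formulas_of_order => //.
rewrite layers_sum natr_sum; apply: eq_bigr => m _.
by rewrite /r mulrCA divff // mulr1.
Qed.

End Layers.

Theorem theorem4p7 (l p : nat) (l_prime : prime l) (p_prime : prime p)
    (l_neq_p : l != p)
    (Gam : nat -> finGroupType)
    (Gam_abelian : forall n, abelian [set: Gam n]%SET)
    (Gam_pgroup : forall n, (p.-group [set: Gam n]%SET)%g)
    (tr : forall n, {morphism [set: Gam n.+1]%SET >-> Gam n})
    (tr_surj : forall n (y : Gam n), exists x, tr n x = y)
    (Qlbar : closedFieldType) (iota : {rmorphism Zl l -> Qlbar})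
    (Qlbar_closure : algebraic_closure_of_Ql iota)
    (M : lmodType (Iwasawa l tr)) (M_sinnott : sinnott_module iota p M) :
  let f := cyclotomic_degree iota p in
  let a := a_const l p (f 1%N) in
  let epsM n := component (epsilon tr iota p n) M in
  let Msum n := direct_sum epsM n in
  let r n : rat := (Zl_rank (epsM n))%:R / (f n)%:R in
  let rho n : rat := (rank_mod_l (epsM n))%:R / (f n)%:R in
  let t n : rat := (card_valuation l (epsM n))%:R / (f n)%:R in
  [/\ forall n, [/\ finitely_generated (Zl_scalars l tr) (epsM n),
                    r n \is a Num.nat & rho n \is a Num.nat],
      torsion_module iota M ->
        forall n, finite_set (epsM n) /\ t n \is a Num.nat,
      forall n, layer_formulas l p a f r n (Zl_rank (Msum n))%:R,
      forall n, layer_formulas l p a f rho n (rank_mod_l (Msum n))%:R &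
      torsion_module iota M ->
        forall n, layer_formulas l p a f t n (card_valuation l (Msum n))%:R].
Proof.
move=> f a epsM Msum r rho t; have iota_inj := Qlbar_closure.1.
have layers tt Mt K X KX n := @layer_formulas_log_invariant l p Gam tr Qlbar iota
  l_prime p_prime l_neq_p Gam_abelian Gam_pgroup tr_surj iota_inj M M_sinnott
  tt Mt K X KX n.
have fg tt Mt n := @layer_fin_gen_tors l p Gam tr Qlbar iota
  l_prime p_prime l_neq_p Gam_abelian Gam_pgroup tr_surj iota_inj M M_sinnott tt Mt n.
have noT : false -> torsion_module iota M by [].
split.
- move=> n; split.
  + have [k [g [gN Ng]]] := fin_gen_ord (fg false noT n).1.
    exists k, g; split=> // y /Ng[c ->]; exists (fun i => Zl_Iwasawa tr (c i)) => // i.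
    by exists (c i).
  + exact: (layers _ noT _ _ (Zl_rank_log l_prime) n).1.
  + exact: (layers _ noT _ _ (l_rank_log l_prime) n).1.
- move=> Mt n; split.
    have [_ qN] := length_log l_prime.
    exact: (quot_card_fset_set (qN _ _ (fg true (fun=> Mt) n))).1.
  exact: (layers _ (fun=> Mt) _ _ (length_log l_prime) n).1.
- by move=> n; exact: (layers _ noT _ _ (Zl_rank_log l_prime) n).2.
- by move=> n; exact: (layers _ noT _ _ (l_rank_log l_prime) n).2.
- by move=> Mt n; exact: (layers _ (fun=> Mt) _ _ (length_log l_prime) n).2.
Qed.
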